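(* Let $n\ge 1$ and let $\mathbf{k}=(k_1,k_2,\ldots,k_n)$ be a strictly increasing sequence of positive integers. The number of twenty-vertex ($20$V) configurations on the quadrangular domain $\mathcal{Q}_{\mathbf{k}}$ (in which the horizontal boundary edges on the west boundary at positions $k_1,\ldots,k_n$ are incoming, while the remaining horizontal boundary edges on the west boundary are outgoing) is equal to $$2^{-n}\sum_{T}\omega_{\mathrm{FSA}}(T),$$ where the sum runs over all triple-free Gelfand--Tsetlin patterns $T$ with $n$ rows and bottom row $\mathbf{k}$.
   Context: **$20$V configurations.** Consider the triangular lattice on $\mathbb{Z}^2$ whose edges are the horizontal and vertical nearest-neighbour edges together with the diagonal edges joining $(i,j)$ and $(i+1,j-1)$ for all $i,j\in\mathbb{Z}$. The domain $\mathcal{Q}_{\mathbf{k}}$ has as vertices the lattice points $(i,j)$ with $1\le i\le n$, $j\le k_n$, $i+j\ge 2$. Internal edges are the edges with both endpoints in $\mathcal{Q}_{\mathbf{k}}$; boundary edges are those with exactly one endpoint in $\mathcal{Q}_{\mathbf{k}}$ (the other endpoint is not regarded as a vertex of the domain). Incoming/outgoing for a boundary edge is understood with respect to its endpoint in $\mathcal{Q}_{\mathbf{k}}$. The boundary edges have fixed orientations: all north boundary edges (other endpoint with second coordinate $k_n+1$) are outgoing; all south boundary edges (crossing the line $i+j=2$, i.e. boundary edges that are not north, east or west boundary edges) are outgoing; all east boundary edges (other endpoint with first coordinate $n+1$) are incoming; on the west boundary (other endpoint with first coordinate $0$) the horizontal edges at positions $k_1,\ldots,k_n$, counted from the bottom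 (position $j$ being the edge at the vertex $(1,j)$), are incoming, and the other horizontal edges and all diagonal edges are outgoing. A $20$V configuration on $\mathcal{Q}_{\mathbf{k}}$ is an orientation of the internal edges such that, together with the fixed boundary orientations, every vertex of $\mathcal{Q}_{\mathbf{k}}$ is incident to exactly three incoming and three outgoing edges. **Triple-free GT patterns.** A Gelfand--Tsetlin (GT) pattern with $n$ rows is a triangular array of integers $T=(T_{i,j})_{1\le j\le i\le n}$ with $T_{i+1,j}\le T_{i,j}\le T_{i+1,j+1}$ for all valid $i,j$; row $n$ is the bottom row. It is triple-free if there is no $(i,j)$ with $T_{i,j}=T_{i,j+1}=T_{i,j+2}$. The upper-left and upper-right neighbours of $T_{i,j}$ are $T_{i-1,j-1}$ and $T_{i-1,j}$ (when they exist). The weight is $\omega_{\mathrm{FSA}}(T)=2^{r}$, where $r$ is the number of entries of $T$ that are not equal to both their upper-left and upper-right neighbours (i.e. $r$ is the total number $n(n+1)/2$ of entries minus the number of pairs $(i,j)$ with $T_{i-1,j-1}=T_{i,j}=T_{i-1,j}$; an entry lacking one of these neighbours is counted in $r$). *)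

(* Defs.v *)
From HB Require Import structures.
From mathcomp Require Import all_boot all_order all_algebra.
From mathcomp Require Import zify.

Set Implicit Arguments.
Unset Strict Implicit.
Unset Printing Implicit Defensive.

Import Order.TTheory GRing.Theory Num.Theory.
Local Open Scope ring_scope.

Definition point : Type := (int * int)%type.

Definition nbrs (z : point) : seq point :=
  [:: (z.1 + 1, z.2); (z.1 - 1, z.2); (z.1, z.2 + 1); (z.1, z.2 - 1);
      (z.1 + 1, z.2 - 1); (z.1 - 1, z.2 + 1)].

Section Domain.

(* The domain Q_k depends on k only through n and m = k_n. *)
Variables n m : nat.

Definition in_dom (z : point) : bool :=
  [&& 1 <= z.1 <= n%:Z, z.2 <= m%:Z & 2 <= z.1 + z.2].

Definition vertex : Type := {z : point | in_dom z}.

HB.instance Definition _ := SubType.on vertex.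
HB.instance Definition _ := Countable.on vertex.

(* A finite code for vertices, used only to equip vertex with its finType
   structure: (i, j) is coded by (i, m - j). *)
Definition vertex_code (v : vertex) : 'I_n.+1 * 'I_(n + m).+1 :=
  (inord `|(val v).1|%N, inord `|m%:Z - (val v).2|%N).

Definition vertex_decode (c : 'I_n.+1 * 'I_(n + m).+1) : option vertex :=
  insub (((c.1 : nat)%:Z, m%:Z - (c.2 : nat)%:Z) : point).

Lemma vertex_codeK : pcancel vertex_code vertex_decode.
Proof.
case=> -[a b] Pab; rewrite /vertex_decode /vertex_code /=.
have /and3P[/andP[/= h1 h2] h3 h4] := Pab.
rewrite !inordK; [|lia..].
have -> : ((Posz `|a|%N, m%:Z - Posz `|m%:Z - b|%N) : point) = (a, b).
  by congr pair; lia.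
by rewrite insubT.
Qed.

HB.instance Definition _ : isFinite vertex := PCanIsFinite vertex_codeK.

Definition adj (u v : vertex) : bool := val v \in nbrs (val u).

(* An orientation of the internal edges is the set of its arcs: (u, v) is in
   the set when the edge uv is directed from u to v. *)
Definition orientation (o : {set vertex * vertex}) : bool :=
  [forall u, forall v,
     if adj u v then ((u, v) \in o) (+) ((v, u) \in o) else (u, v) \notin o].

End Domain.

Section TwentyVertex.

Variables (n : nat) (k : n.-tuple nat).

Definition top : nat := last 0%N k.

(* Is the boundary edge joining v in Q_k to w outside Q_k incoming at v?
   The only edge that is on two sides joins (1, k_n) to (0, k_n + 1); it is
   outgoing according to both. *)
Definition boundary_in (v w : point) : bool :=
  if w.2 == top%:Z + 1 then false (* north *)
  else if w.1 == n%:Z + 1 then true (* east *)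
  else if w.1 == 0 then (* west *)
    (w.2 == v.2) && (v.2 \in [seq j%:Z | j <- k])
  else false (* south *).

Section Degrees.

Variables (o : {set vertex n top * vertex n top}) (v : vertex n top).

(* State, at v, of the edge joining v to its lattice neighbour w. *)
Definition edge_in (w : point) : bool :=
  if insub w is Some w' then (w', v) \in o else boundary_in (val v) w.

Definition edge_out (w : point) : bool :=
  if insub w is Some w' then (v, w') \in o else ~~ boundary_in (val v) w.

Definition balanced : bool :=
  (count edge_in (nbrs (val v)) == 3) && (count edge_out (nbrs (val v)) == 3).

End Degrees.

Definition configs20V : {set {set vertex n top * vertex n top}} :=
  [set o | orientation o && [forall v, balanced o v]].

End TwentyVertex.

Section GelfandTsetlin.

Variable n : nat.

(* Positions of a triangular array; row p and col p are the 1-based i and j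
   of the entry T_{i,j} at position p. *)
Definition tri : finType := {p : 'I_n * 'I_n | (p.2 <= p.1)%N}.

Definition row (p : tri) : nat := (val p).1.+1.
Definition col (p : tri) : nat := (val p).2.+1.

Definition upleft (p q : tri) : bool :=
  (row q == (row p).+1) && (col q == (col p).+1).

Definition upright (p q : tri) : bool :=
  (row q == (row p).+1) && (col q == col p).

Definition is_gt (T : {ffun tri -> int}) : bool :=
  [forall p, forall q, (upright p q ==> (T q <= T p))
                    && (upleft p q ==> (T p <= T q))].

Definition bottom_row (k : n.-tuple nat) (T : {ffun tri -> int}) : bool :=
  [forall p, (row p == n) ==> (T p == (nth 0%N k (col p).-1)%:Z)].

Definition triple_free (T : {ffun tri -> int}) : bool :=
  ~~ [exists p, exists q, exists r,
        [&& row q == row p, col q == (col p).+1,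
            row r == row p, col r == (col p).+2,
            T p == T q & T q == T r]].

Definition special (T : {ffun tri -> int}) (q : tri) : bool :=
  [exists p, upleft p q && (T p == T q)]
  && [exists p, upright p q && (T p == T q)].

Definition weightFSA (T : {ffun tri -> int}) : nat :=
  (2 ^ #|[set q | ~~ special T q]|)%N.

Variable k : n.-tuple nat.

Definition gt_pattern : Type :=
  {T : {ffun tri -> int} | is_gt T && bottom_row k T}.

HB.instance Definition _ := SubType.on gt_pattern.
HB.instance Definition _ := Countable.on gt_pattern.

Lemma gt_bounds (T : gt_pattern) (p : tri) :
  (0 <= val T p) && (val T p <= (\max_(x <- k) x)%:Z).
Proof.
have /andP[/forallP gtT /forallP botT] := valP T.
have [d le_d] : exists d, (n - row p <= d)%N by exists (n - row p)%N.
elim: d p le_d => [|d IHd] p le_d;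
  have lt1 : (row p <= n)%N := ltn_ord (val p).1;
  have le21 : (col p <= row p)%N := valP p.
  have rp : row p == n by lia.
  have /implyP/(_ rp)/eqP -> := botT p; rewrite !lez_nat /=.
  apply: (@leq_bigmax_seq _ _ xpredT id) => //; apply: mem_nth.
  by rewrite size_tuple /col /= in le21 *; lia.
have [le_d'|gt_d] := leqP (n - row p) d; first exact: IHd.
have lt1n : (row p < n)%N by lia.
have lt2n : (col p < n)%N by lia.
have ha : ((val p).2 <= row p)%N by rewrite ltnW.
have hb : (col p <= row p)%N by [].
pose q : tri := Sub (Ordinal lt1n, (val p).2) ha.
pose r : tri := Sub (Ordinal lt1n, Ordinal lt2n) hb.
have rq : row q = (row p).+1 by [].
have rr : row r = (row p).+1 by [].
have dq : (n - row q <= d)%N by lia.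
have dr : (n - row r <= d)%N by lia.
have /andP[q0 _] := IHd q dq; have /andP[_ r1] := IHd r dr.
have /forallP/(_ q)/andP[/implyP uq _] := gtT p.
have /forallP/(_ r)/andP[_ /implyP ur] := gtT p.
have {}uq := uq (introT andP (conj (eqxx _) (eqxx _))).
have {}ur := ur (introT andP (conj (eqxx _) (eqxx _))).
by rewrite (le_trans q0 uq) (le_trans ur r1).
Qed.

Definition gt_code (T : gt_pattern) : {ffun tri -> 'I_(\max_(x <- k) x).+1} :=
  [ffun p => inord `|val T p|%N].

Definition gt_decode (c : {ffun tri -> 'I_(\max_(x <- k) x).+1}) :
    option gt_pattern :=
  insub [ffun p => (c p : nat)%:Z].

Lemma gt_codeK : pcancel gt_code gt_decode.
Proof.
move=> T; rewrite /gt_decode /gt_code.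
suff -> : [ffun p => (([ffun p => inord `|val T p|%N]
      : {ffun tri -> 'I_(\max_(x <- k) x).+1}) p : nat)%:Z] = val T
  by exact: valK.
apply/ffunP => p; rewrite !ffunE; have /andP[h0 h1] := gt_bounds T p.
by rewrite inordK; lia.
Qed.

HB.instance Definition _ : isFinite gt_pattern := PCanIsFinite gt_codeK.

End GelfandTsetlin.

(* Main.v *)
Require Import Defs.
From mathcomp Require Import all_boot all_order all_algebra.
From mathcomp Require Import zify ring lra.
Set Implicit Arguments.
Unset Strict Implicit.
Unset Printing Implicit Defensive.
Import Order.TTheory GRing.Theory Num.Theory.
Local Open Scope ring_scope.

(** Both sides are partition functions of a column-to-column transfer, and the
    two transfers are related by a local commutation relation.

    Read a horizontal edge directed to the right, a diagonal edge directed
    down-right and a vertical edge directed up as occupied by a particle.  At a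
    vertex, three incoming and three outgoing edges means that as many particles
    arrive along the west, north-west and south edges as leave along the east,
    south-east and north edges.  The boundary orientation says that column 1
    receives the particles k_1, ..., k_n, that every column loses exactly one
    particle through its top vertex, and that no particle is left after column
    n.  Let x and y be the occupation words of the particles entering and
    leaving a column (letter at a height = number of particles there).  Vertical
    arrows joining x to y exist, and are then unique, exactly when the positions
    recorded by y interlace those recorded by x (the relation [inter]).  After
    that, each site of y holding one particle sends it along the horizontal or
    along the diagonal edge, and each site holding two sends one along each; the
    diagonal particles move down by one, and this gives the next entering word.
    Write A for the sum over interlacing words with letters at most 2, and S for
    the sum over splittings.  The 20V count is then F_n(k), with F_0 the
    indicator of the empty word and F_(N+1) = A S F_N.

    On the other side, record each row of a Gelfand-Tsetlin pattern by its
    occupation word.  Consecutive rows interlace, triple-free means that the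
    letters are at most 2, and an entry equals both its upper neighbours
    precisely below a pair of equal entries of the previous row.  With Q the
    multiplication by 2^(- number of letters 2), the right-hand side is G_n(k),
    where G_(N+1) = A (2^N Q G_N).

    So F = G follows from S F_N = 2^N Q F_N ([vertex_sum_split]).  This is
    proved by induction on N from the commutation relation S A Q = 2 Q A S:
      S F_(N+1) = S A (S F_N) = 2^N S A Q F_N = 2^(N+1) Q A S F_N
                = 2^(N+1) Q F_(N+1).
    The matrix entries of S A and of A S between two words are computed site by
    site from the bottom, with a state of two bits (vertical arrow, diagonal
    arrow).  The commutation relation then comes from an intertwining relation
    between the two vectors of partial sums ([transfer_relations]), checked on
    the nine possible pairs of letters.  It needs the lowest site of the word to
    be empty; the words that occur have enough empty sites at the bottom because
    all k_j are positive and a particle goes down by at most one per column.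

    The rest identifies the two sides with these recursions: [card_configs] for
    20V configurations and [sum_patterns] for Gelfand-Tsetlin patterns. *)

(** * Column states and interlacing words *)

Lemma big_tuple0 (R : nmodType) (X : finType) (G : seq X -> R) :
  \sum_(t : 0.-tuple X) G t = G [::].
Proof.
by rewrite (big_pred1 [tuple]) // => t; rewrite [t]tuple0 [RHS]eqxx.
Qed.

Lemma big_tuple_cons (R : nmodType) (X : finType) (L : nat) (G : seq X -> R) :
  \sum_(t : L.+1.-tuple X) G t = \sum_(x : X) \sum_(t : L.-tuple X) G (x :: t).
Proof.
rewrite pair_big /=.
rewrite (reindex (fun p : X * L.-tuple X => [tuple of p.1 :: p.2])) //=.
exists (fun t => (thead t, [tuple of behead t])) => [[x t] _|t _] /=.
  by congr pair; apply: val_inj.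
by rewrite [RHS]tuple_eta; apply: val_inj.
Qed.

(** A column state s lists, from the bottom, the pairs (horizontal arrow to the
    right, diagonal arrow down-right) leaving the sites of a column;
    [occupancy s] is the number of particles leaving each site. *)
Definition occupancy (s : seq (bool * bool)) : seq nat :=
  [seq (b.1 + b.2)%N | b : bool * bool <- s].

(** The diagonal arrow of the lowest site, false on the empty state. *)
Definition bottom_diag (s : seq (bool * bool)) : bool := (head (false, false) s).2.

(** The word entering the next column: a horizontal particle keeps its site and a
    diagonal one moves down by one.  A diagonal particle of the lowest site falls
    out. *)
Fixpoint shift (s : seq (bool * bool)) : seq nat :=
  if s is b :: s' then (b.1 + bottom_diag s')%N :: shift s' else [::].

(** [inter u x y]: starting from the vertical arrow u below the lowest site,
    there are vertical arrows making the entering word x and the leaving word y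
    balanced at each site, the topmost one being directed up.  The arrow above a
    site carrying letters a and c is u + a - c, which must be 0 or 1. *)
Fixpoint inter (u : bool) (x y : seq nat) : bool :=
  match x, y with
  | [::], [::] => u
  | a :: x', c :: y' => (c <= u + a <= c.+1)%N && inter (u + a == c.+1)%N x' y'
  | _, _ => false
  end.

(** The number of letters 2. *)
Definition doubles (y : seq nat) : nat := count_mem 2%N y.

Lemma size_occupancy s : size (occupancy s) = size s. Proof. exact: size_map. Qed.
Lemma size_shift s : size (shift s) = size s.
Proof. by elim: s => //= b s ->. Qed.

(** * The commutation relation *)

(** The entry between y and z of splitting followed by interlacing, when the
    lowest site starts with vertical arrow u and diagonal arrow d. *)
Definition split_inter_sum L (u d : bool) (y z : seq nat) : rat :=
  \sum_(s : L.-tuple (bool * bool))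
     [&& occupancy s == y, bottom_diag s == d & inter u (shift s) z]%:R.

(** The entry between y and z of interlacing followed by splitting, with the same
    kind of initial state. *)
Definition inter_split_sum L (v d : bool) (y z : seq nat) : rat :=
  \sum_(s : L.-tuple (bool * bool))
     [&& shift s == z, bottom_diag s == d & inter v y (occupancy s)]%:R.

Lemma big_bool2 (R : nmodType) (G : bool * bool -> R) :
  \sum_(b : bool * bool) G b =
  G (true, true) + G (true, false) + (G (false, true) + G (false, false)).
Proof.
rewrite (eq_bigr (fun p => G (p.1, p.2))); last by case.
by rewrite -(pair_bigA _ (fun a b => G (a, b))) /= !big_bool.
Qed.

Lemma split_inter_sum0 u d : split_inter_sum 0 u d [::] [::] = (~~ d && u)%:R.
Proof.
rewrite /split_inter_sum (big_tuple0 (fun s => [&& occupancy s == [::], bottom_diag s == d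
  & inter u (shift s) [::]]%:R)) /=.
by case: d.
Qed.

Lemma inter_split_sum0 v d : inter_split_sum 0 v d [::] [::] = (~~ d && v)%:R.
Proof.
rewrite /inter_split_sum (big_tuple0 (fun s => [&& shift s == [::], bottom_diag s == d
  & inter v [::] (occupancy s)]%:R)) /=.
by case: d.
Qed.

(** Removing the lowest site: h is its horizontal arrow, d' the diagonal arrow of
    the site above, and the new state is (vertical arrow above the site, d'). *)
Lemma split_inter_sumS L u d c e y z :
  split_inter_sum L.+1 u d (c :: y) (e :: z) =
  \sum_(h : bool) \sum_(d' : bool)
   ((h + d == c) && (e <= u + (h + d') <= e.+1))%N%:R
    * split_inter_sum L (u + (h + d') == e.+1)%N d' y z.
Proof.
rewrite /split_inter_sum (big_tuple_cons _ (fun s =>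
  [&& occupancy s == c :: y, bottom_diag s == d
  & inter u (shift s) (e :: z)]%:R)) big_bool2 /=.
under [in RHS]eq_bigr => h _ do under eq_bigr => d' _ do rewrite mulr_sumr.
under [in RHS]eq_bigr => h _ do rewrite exchange_big /=.
rewrite [in RHS]big_bool /= -!big_split /=.
apply: eq_bigr => s _; rewrite !big_bool /= !eqseq_cons.
by case: d; case: (bottom_diag s); case: (occupancy s == y);
   rewrite /= ?andbF /= ?mul0r ?mulr0 ?addr0 ?add0r ?andbT /= -?natrM ?mulnb -?andbA.
Qed.

Lemma inter_split_sumS L v d c e y z :
  inter_split_sum L.+1 v d (c :: y) (e :: z) =
  \sum_(h : bool) \sum_(d' : bool)
   ((h + d' == e) && (h + d <= v + c <= (h + d).+1))%N%:R
    * inter_split_sum L (v + c == (h + d).+1)%N d' y z.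
Proof.
rewrite /inter_split_sum (big_tuple_cons _ (fun s =>
  [&& shift s == e :: z, bottom_diag s == d
  & inter v (c :: y) (occupancy s)]%:R)) big_bool2 /=.
under [in RHS]eq_bigr => h _ do under eq_bigr => d' _ do rewrite mulr_sumr.
under [in RHS]eq_bigr => h _ do rewrite exchange_big /=.
rewrite [in RHS]big_bool /= -!big_split /=.
apply: eq_bigr => s _; rewrite !big_bool /= !eqseq_cons.
by case: d; case: (bottom_diag s); case: (shift s == z);
   rewrite /= ?andbF /= ?mul0r ?mulr0 ?addr0 ?add0r ?andbT /= -?natrM ?mulnb -?andbA.
Qed.

(** The intertwining relations between the two transfers, with the weight 1/2 of
    each letter 2 put on the word z in the first one and on y in the second one.
    In the third relation the states (0, 0) and (1, 1) appear together because
    they have the same charge, vertical arrow minus diagonal arrow, which is what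
    the letters read so far determine. *)
Lemma transfer_relations L (y z : seq nat) :
  size y = L -> size z = L -> all (leq^~ 2%N) y -> all (leq^~ 2%N) z ->
  let l u d := 2^-1 ^+ doubles z * split_inter_sum L u d y z in
  let r u d := 2^-1 ^+ doubles y * inter_split_sum L u d y z in
  [/\ l false true = 2 * r false true, l true false = r true false,
      l false false + l true true = 2 * r false false
    & r true true = r false false].
Proof.
elim: L y z => [|L IHL] [|c y] [|e z] //=.
  by move=> _ _ _ _; rewrite !split_inter_sum0 !inter_split_sum0 /doubles /=; split; lra.
move=> [sy] [sz] /andP[cle yle] /andP[ele zle].
have [] := IHL _ _ sy sz yle zle.
rewrite !split_inter_sumS !inter_split_sumS !big_bool /doubles /=.
set pz : rat := 2^-1 ^+ _; set py : rat := 2^-1 ^+ count_mem 2%N y.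
have e01 : (0%N == 1%N) = false by [].
have e02 : (0%N == 2%N) = false by [].
have e10 : (1%N == 0%N) = false by [].
case: c cle => [|[|[|//]]] _; case: e ele => [|[|[|//]]] _ /=;
 rewrite !(addn0, add0n, addSn, addnS) !(eqxx, eqSS, e01, e02, e10) /=;
 rewrite !(mul0r, mul1r, add0r, addr0, mulr0, add0n, exprS, expr0) -?/pz -?/py;
 by clearbody pz py => h1 h2 h3 h4; split; lra.
Qed.

(** * The two recursions *)

(** Words with letters at most 2, as a finite type. *)
Definition word L (z : L.-tuple 'I_3) : seq nat := map val z.

(** The number of ways to fill N successive columns with L sites when the word x
    enters the first one and nothing leaves the last one. *)
Fixpoint vertex_sum (L N : nat) (x : seq nat) : rat :=
  if N is N'.+1 then
    \sum_(s : L.-tuple (bool * bool) | ~~ bottom_diag s && inter false x (occupancy s))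
       vertex_sum L N' (shift s)
  else (all (pred1 0%N) x)%:R.

(** The weighted number of sequences of N successively interlacing words below
    x, the last one carrying no particle. *)
Fixpoint pattern_sum (L N : nat) (x : seq nat) : rat :=
  if N is N'.+1 then
    \sum_(z : L.-tuple 'I_3 | inter false x (word z))
       2 ^+ N' * 2^-1 ^+ doubles (word z) * pattern_sum L N' (word z)
  else (all (pred1 0%N) x)%:R.

Lemma size_word L (z : L.-tuple 'I_3) : size (word z) = L.
Proof. by rewrite size_map size_tuple. Qed.

Lemma word_le2 L (z : L.-tuple 'I_3) : all (leq^~ 2%N) (word z).
Proof. by rewrite all_map; apply/allP => i _ /=; rewrite -ltnS. Qed.

Lemma word_inj L : injective (@word L).
Proof. by move=> y z /(inj_map val_inj) /val_inj. Qed.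

Lemma wordP L (w : seq nat) :
  size w = L -> all (leq^~ 2%N) w -> exists z : L.-tuple 'I_3, word z = w.
Proof.
move=> sw /allP lew.
have swi : size (map (@inord 2) w) == L by rewrite size_map sw.
exists (Tuple swi); rewrite /word /= -map_comp map_id_in // => a /lew ale /=.
by rewrite inordK.
Qed.

Lemma sum_word L (w : seq nat) (G : seq nat -> rat) :
  size w = L -> all (leq^~ 2%N) w ->
  \sum_(z : L.-tuple 'I_3 | w == word z) G (word z) = G w.
Proof.
move=> sw lew; have [z zw] := wordP sw lew.
rewrite (big_pred1 z) ?zw // => t /=.
by rewrite -zw (inj_eq (@word_inj L)) eq_sym.
Qed.

Lemma occupancy_le2 s : all (leq^~ 2%N) (occupancy s).
Proof. by rewrite all_map; apply/allP => -[[] []]. Qed.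

Lemma shift_le2 s : all (leq^~ 2%N) (shift s).
Proof. by elim: s => // b s /= ->; case: b.1; case: (bottom_diag s). Qed.

(** The N lowest sites carry nothing. *)
Definition empty_below N (x : seq nat) := all (pred1 0%N) (take N x).

(** Interlacing only moves particles up. *)
Lemma inter_empty_below N x y :
  inter false x y -> empty_below N x -> empty_below N y.
Proof.
elim: x y N => [|a x IH] [|c y] [|N] //=.
rewrite /empty_below /= => /andP[/andP[ca _]] + /andP[/eqP a0].
move: ca; rewrite a0 addn0 leqn0 => /eqP ->.
by move=> /IH{}IH /IH.
Qed.

(** Splitting moves particles down by at most one site. *)
Lemma shift_empty_below N s :
  empty_below N.+1 (occupancy s) -> empty_below N (shift s).
Proof.
elim: s N => [|[h d] s IH] [|N] //=; rewrite /empty_below /= in IH *.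
case: h; case: d => //= ms; apply/andP; split; last exact: IH.
by case: s ms {IH} => [|[[] []] s].
Qed.

(** The state (1, 1) is impossible when the lowest site is empty, as the second
    bit is the diagonal arrow of that site; this turns the third relation of [transfer_relations] into the
    commutation relation. *)
Lemma split_inter_sum_bottom L y z : head 0%N y = 0%N -> size y = L ->
  split_inter_sum L true true y z = 0.
Proof.
move=> y0 sy; rewrite /split_inter_sum big1 // => s _.
case: (occupancy s =P y) => //= ys.
suff -> : bottom_diag s = false by [].
by move: y0; rewrite -ys; case: (tval s) => [|[[] []]].
Qed.

(** Sum over the states of a column, organised by its occupation word. *)
Lemma sum_by_occupancy L (P : pred (seq nat)) (f : seq (bool * bool) -> rat) :
  \sum_(s : L.-tuple (bool * bool) | ~~ bottom_diag s && P (occupancy s)) f s =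
  \sum_(z : L.-tuple 'I_3 | P (word z))
    \sum_(s : L.-tuple (bool * bool) | (occupancy s == word z) && ~~ bottom_diag s) f s.
Proof.
rewrite (exchange_big_dep (fun s : L.-tuple _ => ~~ bottom_diag s && P (occupancy s))) /=.
  apply: eq_bigr => s /andP[ds Ps].
  rewrite (eq_bigl (fun z => occupancy s == word z)); last first.
    by move=> z /=; rewrite ds andbT; case: eqP => [<-|]; rewrite ?Ps ?andbF.
  by rewrite (sum_word (fun _ => f s)) ?occupancy_le2 // size_occupancy size_tuple.
by move=> z s Pz /andP[/eqP -> ->].
Qed.

Lemma occupancy_eq0 s :
  all (pred1 0%N) (occupancy s) = ~~ bottom_diag s && all (pred1 0%N) (shift s).
Proof.
elim: s => //= b s IH; rewrite -/(occupancy s) IH.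
by case: b => [[] []] //=; case: (bottom_diag s).
Qed.

(** The sum over the splittings of y only depends on the number of letters 2: it
    is an eigenvector equation for the splitting operator. *)
Lemma vertex_sum_split L N y : size y = L -> all (leq^~ 2%N) y ->
  empty_below N y ->
  \sum_(s : L.-tuple (bool * bool) | (occupancy s == y) && ~~ bottom_diag s)
     vertex_sum L N (shift s)
  = 2 ^+ N * 2^-1 ^+ doubles y * vertex_sum L N y.
Proof.
elim: N y => [|N IH] y sy ley suppy.
  rewrite expr0 mul1r /=; case y0: (all _ y); last first.
    rewrite mulr0 big1 // => s /andP[/eqP ms ds].
    by have := occupancy_eq0 s; rewrite ms ds y0 /= => <-.
  have yE : y = nseq L 0%N by rewrite -sy; apply/all_pred1P.
  have -> : doubles y = 0%N by rewrite yE /doubles count_nseq mul0n.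
  rewrite mulr1 expr0 (big_pred1 [tuple of nseq L (false, false)]) /=.
    by move: (occupancy_eq0 (nseq L (false, false)));
       rewrite /occupancy map_nseq all_nseq orbT => /esym/andP[_ ->].
  move=> s /=; rewrite -(inj_eq val_inj) /=; apply/andP/eqP => [[/eqP ms _]|->].
    have /all_pred1P : all (pred1 (false, false)) s.
      have := y0; rewrite -ms all_map; apply: sub_all.
      by case=> [[] []].
    by rewrite size_tuple.
  rewrite yE /occupancy map_nseq; split=> //.
  by case: (L).
set c := 2 ^+ N.+1 * _.
transitivity (\sum_(s : L.-tuple (bool * bool) | (occupancy s == y) && ~~ bottom_diag s)
    \sum_(z : L.-tuple 'I_3 | inter false (shift s) (word z))
      2 ^+ N * 2^-1 ^+ doubles (word z) * vertex_sum L N (word z)).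
  apply: eq_bigr => s /andP[/eqP ms ds] /=.
  rewrite (sum_by_occupancy L (inter false (shift s))
    (fun s => vertex_sum L N (shift s))).
  apply: eq_bigr => z xz; rewrite IH ?size_word ?word_le2 //.
  by apply: inter_empty_below xz _; apply: shift_empty_below; rewrite ms.
transitivity (\sum_(z : L.-tuple 'I_3)
   2 ^+ N * (2^-1 ^+ doubles (word z) * split_inter_sum L false false y (word z))
   * vertex_sum L N (word z)).
  rewrite (exchange_big_dep predT) //=; apply: eq_bigr => z _.
  rewrite sumr_const -mulr_natr.
  suff -> : split_inter_sum L false false y (word z) =
    #|[pred s : L.-tuple (bool * bool) |
    (occupancy s == y) && ~~ bottom_diag s && inter false (shift s) (word z)]|%:R by ring.
  rewrite /split_inter_sum -sum1_card natr_sum [RHS]big_mkcond; apply: eq_bigr => s _ /=.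
  by rewrite inE andbA eqbF_neg; case: ifP.
(* The commutation relation moves the splitting after the interlacing. *)
transitivity (\sum_(z : L.-tuple 'I_3)
   c * inter_split_sum L false false y (word z) * vertex_sum L N (word z)).
  apply: eq_bigr => z _; congr (_ * _).
  have [_ _ + _] := transfer_relations sy (size_word z) ley (word_le2 z).
  rewrite split_inter_sum_bottom //; last first.
    by case: (y) suppy => //= a w /andP[/eqP].
  by rewrite mulr0 addr0 => ->; rewrite /c exprS; ring.
rewrite /= mulr_sumr.
transitivity (\sum_(s : L.-tuple (bool * bool) |
    ~~ bottom_diag s && inter false y (occupancy s))
  \sum_(z : L.-tuple 'I_3 | shift s == word z) c * vertex_sum L N (word z)); last first.
  apply: eq_bigr => s _.
  by rewrite (sum_word (fun w => c * vertex_sum L N w))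
    ?size_shift ?size_tuple ?shift_le2.
rewrite (exchange_big_dep predT) //=; apply: eq_bigr => z _.
rewrite sumr_const -mulr_natr.
suff -> : inter_split_sum L false false y (word z) =
  #|[pred s : L.-tuple (bool * bool) |
  ~~ bottom_diag s && inter false y (occupancy s) && (shift s == word z)]|%:R by ring.
rewrite /inter_split_sum -sum1_card natr_sum [RHS]big_mkcond; apply: eq_bigr => s _ /=.
by rewrite inE andbC eqbF_neg; case: ifP.
Qed.

(** With [vertex_sum_split], the sum over splittings in the recursion for
    [vertex_sum] becomes the weight in the recursion for [pattern_sum]. *)
Lemma vertex_sum_pattern_sum L N x : empty_below N.-1 x ->
  vertex_sum L N x = pattern_sum L N x.
Proof.
elim: N x => //= N IH x suppx.
rewrite (sum_by_occupancy L (inter false x) (fun s => vertex_sum L N (shift s))).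
apply: eq_bigr => z xz; have zN := inter_empty_below xz suppx.
rewrite vertex_sum_split ?size_word ?word_le2 // IH //.
by case: (N) zN => //= M; rewrite /empty_below; case: (word z) => //= a w;
   elim: w M a => [|b w IHw] [|M] a //= /and3P[/eqP -> /eqP -> h];
   rewrite /= IHw //= h.
Qed.

(** * Recursions as sums over chains *)

(** A list t of column states filling successive columns, where x enters the
    first one, no particle falls out and nothing leaves the last one. *)
Fixpoint vertex_chain (x : seq nat) (t : seq (seq (bool * bool))) : bool :=
  if t is s :: t' then
    [&& ~~ bottom_diag s, inter false x (occupancy s)
      & vertex_chain (shift s) t']
  else all (pred1 0%N) x.

Lemma vertex_sum_card L N x :
  vertex_sum L N x =
  #|[set t : N.-tuple (L.-tuple (bool * bool)) | vertex_chain x (map val t)]|%:R.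
Proof.
rewrite -sum1dep_card natr_sum big_mkcond /=.
elim: N x => [|N IH] x /=.
  rewrite (big_tuple0 (fun t => if vertex_chain x (map val t) then 1%:R else 0)) /=.
  by case: ifP.
rewrite (big_tuple_cons _ (fun t => if vertex_chain x (map val t) then 1%:R else 0)).
rewrite big_mkcond /=; apply: eq_bigr => s _.
rewrite IH; case: ifP => Ps.
  by apply: eq_bigr => t _; move: Ps => /andP[-> ->].
rewrite big1 // => t _.
by move: Ps; case: (bottom_diag s) => //= ->.
Qed.

(** The state of site p of the i-th column, no arrow outside the range. *)
Definition bit (t : seq (seq (bool * bool))) i p :=
  nth (false, false) (nth [::] t i) p.

Lemma nth_shift s p : (p < size s)%N ->
  nth 0%N (shift s) p =
  ((nth (false, false) s p).1 + (nth (false, false) s p.+1).2)%N.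
Proof.
elim: s p => // b s IH [|p] /=; first by rewrite /bottom_diag -nth0.
by rewrite ltnS => /IH.
Qed.

Lemma nth_occupancy s p :
  nth 0%N (occupancy s) p =
  ((nth (false, false) s p).1 + (nth (false, false) s p).2)%N.
Proof.
have [ps|sp] := ltnP p (size s); first by rewrite (nth_map (false, false)).
by rewrite !nth_default ?size_occupancy.
Qed.

(** The vertical arrow below site p, when the one below site 0 is u. *)
Fixpoint flux (u : bool) (x y : seq nat) (p : nat) : bool :=
  match p, x, y with
  | p'.+1, a :: x', c :: y' => flux (u + a == c.+1)%N x' y' p'
  | _, _, _ => u
  end.

Lemma inter_flux u x y : inter u x y ->
  [/\ size x = size y, flux u x y 0 = u, flux u x y (size x)
    & forall p, (p < size x)%N ->
      (flux u x y p + nth 0 x p = nth 0 y p + flux u x y p.+1)%N].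
Proof.
elim: x y u => [|a x IH] [|c y] u //= => /andP[cua /IH[<- U0 UL Up]].
split=> // -[_|p] /=; last by rewrite ltnS => /Up.
by rewrite U0; lia.
Qed.

Lemma interP u x y : size x = size y ->
  reflect (exists U : nat -> bool, [/\ U 0%N = u, U (size x)
    & forall p, (p < size x)%N ->
        (U p + nth 0 x p = nth 0 y p + U p.+1)%N]) (inter u x y).
Proof.
move=> sxy; apply: (iffP idP) => [/inter_flux[_ U0 UL Up]|].
  by exists (flux u x y).
elim: x y u sxy => [|a x IH] [|c y] u //= => [_|[/IH{}IH]] [U [U0 UL Up]].
  by rewrite -U0.
have := Up 0%N isT; rewrite /= U0 => e0.
apply/andP; split; first by case: (U 1%N) e0; lia.
apply: IH; exists (fun p => U p.+1); split=> [|//|p pl]; last exact: (Up p.+1 pl).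
by case: (U 1%N) e0 => /= e0; lia.
Qed.

(** The word entering the i-th column (counted from 0) of the chain t, where x
    enters the first one. *)
Definition inword x t i := if i is i'.+1 then shift (nth [::] t i') else x.

Lemma vertex_chainP x t :
  reflect ((forall i, (i < size t)%N ->
             ~~ bottom_diag (nth [::] t i)
             && inter false (inword x t i) (occupancy (nth [::] t i)))
           /\ all (pred1 0%N) (inword x t (size t)))
          (vertex_chain x t).
Proof.
elim: t x => [|s t IH] x /=; first by apply: (iffP idP) => [|[]].
apply: (iffP and3P) => [[ds xs /IH[ch fin]]|[ch fin]].
  split; last by move: fin; case: (size t).
  by case=> [_|i] /=; [rewrite ds|rewrite ltnS => /ch; case: i].
have /andP[ds xs] := ch 0%N isT; split=> //; apply/IH; split.
  by move=> i it; have := ch i.+1 it; case: i it.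
by move: fin; case: (size t).
Qed.


(** * Twenty-vertex configurations as chains *)

(** Site p of column i.  The n lowest sites of the window of top k + n sites lie
    below the height 1. *)
Definition pt (n i p : nat) : point := (i%:Z, p%:Z + 1 - n%:Z).

Section Flow.

Variables (n : nat) (k : n.-tuple nat).
Implicit Types (o : {set vertex n (top k) * vertex n (top k)}).

(** Is the edge joining z and w directed from z to w?  This covers internal and
    boundary edges; it is false when neither end is a vertex of the domain. *)
Definition flow o (z w : point) : bool :=
  if insub z is Some v then edge_out o v w
  else if insub w is Some v then edge_in o v z else false.

Let dom := in_dom n (top k).

Lemma flow_vv o u v : flow o (val u) (val v) = ((u, v) \in o).
Proof. by rewrite /flow valK /edge_out valK. Qed.

Lemma flow_out o z w : dom z -> ~~ dom w -> flow o z w = ~~ boundary_in k z w.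
Proof.
by move=> dz dw; rewrite /flow insubT /edge_out insubN.
Qed.

Lemma flow_in o z w : ~~ dom z -> dom w -> flow o z w = boundary_in k w z.
Proof.
by move=> dz dw; rewrite /flow insubN // insubT /edge_in insubN.
Qed.

Lemma flow_none o z w : ~~ dom z -> ~~ dom w -> flow o z w = false.
Proof. by move=> dz dw; rewrite /flow !insubN. Qed.

Lemma edge_outE o v w : edge_out o v w = flow o (val v) w.
Proof. by rewrite /flow valK. Qed.

Lemma edge_inE o v w : edge_in o v w = flow o w (val v).
Proof.
have [dw|dw] := boolP (dom w); last first.
  by rewrite (flow_in _ dw (valP v)) /edge_in insubN.
by rewrite -[w]/(val (Sub w dw : vertex n (top k))) flow_vv /edge_in valK.
Qed.

Lemma nbrs_sym z w : (w \in nbrs z) = (z \in nbrs w).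
Proof.
case: z w => a b [c d]; rewrite /nbrs !inE /= !xpair_eqE; lia.
Qed.

Lemma flowC o z w : orientation o -> w \in nbrs z -> dom z ->
  flow o w z = ~~ flow o z w.
Proof.
move=> /forallP ori wz dz; have [dw|dw] := boolP (dom w); last first.
  by rewrite flow_in // flow_out ?negbK.
have /forallP/(_ (Sub w dw : vertex n (top k))) := ori (Sub z dz).
rewrite /adj !SubK wz -!flow_vv !SubK.
by case: flow => /=; case: flow.
Qed.

(** For an orientation, being balanced is conservation of the particles: those
    arriving from the south, west and north-west are as many as those leaving to
    the east, south-east and north. *)
Lemma balancedE o v : orientation o ->
  let z := val v in
  balanced o v =
  (flow o (z.1, z.2 - 1)%R z + flow o (z.1 - 1, z.2)%R z + flow o (z.1 - 1, z.2 + 1)%R z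
   == flow o z (z.1 + 1, z.2)%R + flow o z (z.1 + 1, z.2 - 1)%R
      + flow o z (z.1, z.2 + 1)%R)%N.
Proof.
move=> ori z; have dz : dom z := valP v.
have C w : w \in nbrs z -> flow o w z = ~~ flow o z w by move=> ?; apply: flowC.
rewrite /balanced /nbrs -/z /= !edge_inE !edge_outE -/z !C ?inE ?eqxx ?orbT //.
by do 6!case: (flow o z _).
Qed.

Let L := (top k + n)%N.
Let P := pt n.

Lemma in_dom_pt i p :
  dom (P i p) = [&& (0 < i <= n)%N, (p < L)%N & (n < i + p)%N].
Proof. by rewrite /dom /in_dom /L /P /pt /=; lia. Qed.

Lemma dom_ptE z : dom z -> exists i p, z = P i p.
Proof.
case: z => a b; rewrite /dom /in_dom /= => ab.
exists (absz a), (absz (b + n%:Z - 1)%R); rewrite /P /pt; congr pair; lia.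
Qed.

(** The six lattice directions in site coordinates. *)
Variant pt_nbrs : nat -> nat -> nat -> nat -> Prop :=
  | NbrE i p : pt_nbrs i p i.+1 p
  | NbrSE i p : pt_nbrs i p.+1 i.+1 p
  | NbrN i p : pt_nbrs i p i p.+1
  | NbrW i p : pt_nbrs i.+1 p i p
  | NbrNW i p : pt_nbrs i.+1 p i p.+1
  | NbrS i p : pt_nbrs i p.+1 i p.

Lemma nbrs_ptE z w : dom z -> w \in nbrs z ->
  exists i p i' p', [/\ z = P i p, w = P i' p' & pt_nbrs i p i' p'].
Proof.
move=> dz; have [i [p zE]] := dom_ptE dz; move: dz; rewrite zE in_dom_pt.
case: i zE => [|i] zE; case: p zE => [|p] zE ip; try lia.
rewrite /nbrs !inE; case: w => a b; rewrite !xpair_eqE /= => ab.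
exists i.+1, p.+1.
have [[i' p'] [/= wE d]] : exists q, (a, b) = P q.1 q.2 /\ pt_nbrs i.+1 p.+1 q.1 q.2.
  case/or4P: ab => [ab|ab|ab|/or3P[]ab].
  - exists (i.+2, p.+1); split; [rewrite /P /pt /=; congr pair; lia|exact: NbrE].
  - exists (i, p.+1); split; [rewrite /P /pt /=; congr pair; lia|exact: NbrW].
  - exists (i.+1, p.+2); split; [rewrite /P /pt /=; congr pair; lia|exact: NbrN].
  - exists (i.+1, p); split; [rewrite /P /pt /=; congr pair; lia|exact: NbrS].
  - exists (i.+2, p); split; [rewrite /P /pt /=; congr pair; lia|exact: NbrSE].
  - exists (i, p.+2); split; [rewrite /P /pt /=; congr pair; lia|exact: NbrNW].
by exists i', p'.
Qed.

Lemma pt_nbrs_nbrs i p i' p' : pt_nbrs i p i' p' -> P i' p' \in nbrs (P i p).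
Proof. by case=> {}i {}p; rewrite /nbrs !inE /P /pt !xpair_eqE /=; lia. Qed.

(** The sites of the incoming arrows of the west boundary. *)
Definition kpos := [seq (j + n).-1 | j <- k].

(** The word entering column 1. *)
Definition kword := mkseq (fun p => count_mem p kpos) L.

Hypothesis k_gt0 : all (fun j => 1 <= j)%N k.
Hypothesis k_sorted : sorted ltn k.

Lemma mem_kpos p : (p%:Z + 1 - n%:Z \in [seq j%:Z | j <- k]) = (p \in kpos).
Proof.
apply/mapP/mapP => -[j jk jE]; exists j => //; first by lia.
by have := allP k_gt0 j jk; lia.
Qed.

Lemma boundary_in_pt i p i' p' :
  boundary_in k (P i p) (P i' p') =
  if p' == L then false else if i' == n.+1 then true
  else if i' == 0%N then (p' == p) && (p \in kpos) else false.
Proof.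
rewrite /boundary_in /P /pt /= mem_kpos.
have -> : (p'%:Z + 1 - n%:Z == (top k)%:Z + 1) = (p' == L) by rewrite /L; lia.
have -> : (i'%:Z == n%:Z + 1) = (i' == n.+1) by lia.
have -> : (i'%:Z == 0) = (i' == 0%N) by lia.
by have -> : (p'%:Z + 1 - n%:Z == p%:Z + 1 - n%:Z) = (p' == p) by lia.
Qed.

(** The horizontal, diagonal and vertical arrows of a configuration: [hor] and
    [dia] leave site p of column i, and [ver] is on the edge below it.  At
    p = 0, which is outside the domain, [dia] and [ver] are false. *)
Definition hor o i p := flow o (P i p) (P i.+1 p).
Definition dia o i p := if p is p'.+1 then flow o (P i p) (P i.+1 p') else false.
Definition ver o i p := if p is p'.+1 then flow o (P i p') (P i p) else false.

Arguments dia o i p : simpl never.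
Arguments ver o i p : simpl never.

Lemma balanced_pt o (v : vertex n (top k)) i p : orientation o ->
  val v = P i.+1 p.+1 ->
  balanced o v =
  (ver o i.+1 p.+1 + (hor o i p.+1 + dia o i p.+2)
   == hor o i.+1 p.+1 + dia o i.+1 p.+1 + ver o i.+1 p.+2)%N.
Proof.
move=> ori vE; rewrite balancedE // vE /ver /hor /dia.
have -> : ((P i.+1 p.+1).1, (P i.+1 p.+1).2 - 1) = P i.+1 p.
  by rewrite /P /pt /=; congr pair; lia.
have -> : ((P i.+1 p.+1).1, (P i.+1 p.+1).2 + 1) = P i.+1 p.+2.
  by rewrite /P /pt /=; congr pair; lia.
have -> : ((P i.+1 p.+1).1 - 1, (P i.+1 p.+1).2) = P i p.+1.
  by rewrite /P /pt /=; congr pair; lia.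
have -> : ((P i.+1 p.+1).1 + 1, (P i.+1 p.+1).2) = P i.+2 p.+1.
  by rewrite /P /pt /=; congr pair; lia.
have -> : ((P i.+1 p.+1).1 - 1, (P i.+1 p.+1).2 + 1) = P i p.+2.
  by rewrite /P /pt /=; congr pair; lia.
have -> : ((P i.+1 p.+1).1 + 1, (P i.+1 p.+1).2 - 1) = P i.+2 p.
  by rewrite /P /pt /=; congr pair; lia.
by rewrite addnA.
Qed.

Lemma kpos_ge p : p \in kpos -> (n <= p)%N.
Proof. by case/mapP => j /(allP k_gt0) /= ? ->; lia. Qed.

Lemma hor_west o p : (p < L)%N -> (0 < n)%N -> hor o 0 p = (p \in kpos).
Proof.
move=> pL n0; rewrite /hor.
have d0 : ~~ dom (P 0 p) by rewrite in_dom_pt.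
have [d1|d1] := boolP (dom (P 1 p)).
  by rewrite flow_in // boundary_in_pt !eqxx /= ltn_eqF.
rewrite flow_none //; apply/esym/negbTE/negP => /kpos_ge.
by move: d1; rewrite in_dom_pt; lia.
Qed.

Lemma dia_west o p : dia o 0 p = false.
Proof.
case: p => // p; rewrite /dia.
have d0 : ~~ dom (P 0 p.+1) by rewrite in_dom_pt.
have [d1|d1] := boolP (dom (P 1 p)); last by rewrite flow_none.
by rewrite flow_in // boundary_in_pt; case: eqP => //; case: eqP => //= _ _; lia.
Qed.

Lemma dia_north o i : (i < n)%N -> dia o i L = false.
Proof.
move=> i_n; case E : L => [|p] //; rewrite /dia.
have d0 : ~~ dom (P i p.+1) by rewrite in_dom_pt -E ltnn andbF.
have [d1|d1] := boolP (dom (P i.+1 p)); last by rewrite flow_none.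
by rewrite flow_in // boundary_in_pt E eqxx.
Qed.

Lemma hor_east o p : (p < L)%N -> hor o n p = false.
Proof.
move=> pL; rewrite /hor.
have d1 : ~~ dom (P n.+1 p) by rewrite in_dom_pt; lia.
have [d0|d0] := boolP (dom (P n p)); last by rewrite flow_none.
by rewrite flow_out // boundary_in_pt eqxx (ltn_eqF pL).
Qed.

Lemma dia_east o p : (p <= L)%N -> dia o n p = false.
Proof.
case: p => // p pL; rewrite /dia.
have d1 : ~~ dom (P n.+1 p) by rewrite in_dom_pt; lia.
have [d0|d0] := boolP (dom (P n p.+1)); last by rewrite flow_none.
by rewrite flow_out // boundary_in_pt eqxx (ltn_eqF pL).
Qed.

Lemma ver_north o i : (0 < top k)%N -> (i < n)%N -> ver o i.+1 L.
Proof.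
move=> m0 i_n; case E : L => [|p]; first by move: E; rewrite /L; lia.
rewrite /ver.
have d1 : ~~ dom (P i.+1 p.+1) by rewrite in_dom_pt -E ltnn andbF.
have d0 : dom (P i.+1 p) by rewrite in_dom_pt; move: E; rewrite /L; lia.
by rewrite flow_out // boundary_in_pt E eqxx.
Qed.

(** A site p of column i with i + p <= n is outside the domain: no particle
    travels there. *)
Lemma hor_below o i p : (i < n)%N -> (p < L)%N -> (i.+1 + p <= n)%N ->
  hor o i.+1 p = false.
Proof.
move=> i_n pL ipn; rewrite /hor.
have d0 : ~~ dom (P i.+1 p) by rewrite in_dom_pt; lia.
have [d1|d1] := boolP (dom (P i.+2 p)); last by rewrite flow_none.
move: (d1); rewrite in_dom_pt => d1'.
by rewrite flow_in // boundary_in_pt (ltn_eqF pL) /=; case: eqP => //; lia.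
Qed.

Lemma dia_below o i p : (i + p <= n)%N -> dia o i p = false.
Proof.
case: p => // p ipn; rewrite /dia.
have d0 : ~~ dom (P i p.+1) by rewrite in_dom_pt; lia.
have d1 : ~~ dom (P i.+1 p) by rewrite in_dom_pt; lia.
by rewrite flow_none.
Qed.

Lemma ver_below o i p : (i < n)%N -> (p < L)%N -> (i + p <= n)%N ->
  ver o i.+1 p = false.
Proof.
case: p => // p i_n pL ipn; rewrite /ver.
have d0 : ~~ dom (P i.+1 p) by rewrite in_dom_pt; lia.
have [d1|d1] := boolP (dom (P i.+1 p.+1)); last by rewrite flow_none.
by rewrite flow_in // boundary_in_pt (ltn_eqF (ltnW pL)) /=; case: eqP => //; lia.
Qed.


Hypothesis n_gt0 : (0 < n)%N.

Lemma size_k_gt0 : (0 < size k)%N. Proof. by rewrite size_tuple. Qed.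

Lemma top_in : top k \in (k : seq nat).
Proof. by rewrite /top; case: (tval k) size_k_gt0 => //= a l _; exact: mem_last. Qed.

Lemma top_gt0 : (0 < top k)%N.
Proof. exact: (allP k_gt0) top_in. Qed.

Lemma le_top j : j \in (k : seq nat) -> (j <= top k)%N.
Proof.
rewrite /top; case: (tval k) k_sorted => //= a l.
elim: l a j => [|b l IH] a j /=; first by rewrite inE => _ /eqP ->.
move=> /andP[ab /IH{}IH]; rewrite inE => /predU1P[->|/IH //].
by apply: leq_trans (ltnW ab) _; apply: IH; exact: mem_head.
Qed.

Lemma uniq_kpos : uniq kpos.
Proof.
rewrite map_inj_in_uniq; first exact: (sorted_uniq ltn_trans ltnn).
by move=> a b /(allP k_gt0) /= ? /(allP k_gt0) /= ? ; lia.
Qed.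

Lemma nth_kword p : (p < L)%N -> nth 0%N kword p = (p \in kpos).
Proof. by move=> pL; rewrite nth_mkseq // count_uniq_mem // uniq_kpos. Qed.

Lemma size_kword : size kword = L. Proof. exact: size_mkseq. Qed.

(** Conservation also holds at the sites of the window below the domain, where all
    arrows are absent. *)
Lemma conservation o i p : orientation o -> [forall v, balanced o v] ->
  (i < n)%N -> (p < L)%N ->
  (ver o i.+1 p + (hor o i p + dia o i p.+1)
   = hor o i.+1 p + dia o i.+1 p + ver o i.+1 p.+1)%N.
Proof.
move=> ori /forallP bal i_n pL.
have [ipn|nip] := leqP (i.+1 + p) n.
  have m0 := top_gt0.
  rewrite hor_below // !dia_below // ?ver_below //; try lia.
  case: i i_n ipn => [|i] i_n ipn.
    rewrite hor_west // addn0 add0n; apply/eqP; rewrite eqb0.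
    by apply/negP => /kpos_ge; lia.
  by rewrite hor_below //; lia.
case: p pL nip => [|p] pL nip; first by rewrite addn0 ltnNge i_n in nip.
have d : dom (P i.+1 p.+1) by rewrite in_dom_pt; lia.
by apply/eqP; rewrite -(balanced_pt (v := Sub (P i.+1 p.+1) d)) ?SubK.
Qed.

(** The column states of a configuration. *)
Definition column o i := mkseq (fun p => (hor o i p, dia o i p)) L.
Definition chain_of o := mkseq (fun i => column o i.+1) n.

Lemma size_column o i : size (column o i) = L. Proof. exact: size_mkseq. Qed.

Lemma nth_chain_of o i : (i < n)%N -> nth [::] (chain_of o) i = column o i.+1.
Proof. by move=> i_n; rewrite nth_mkseq. Qed.

Lemma nth_inword o i p : (i <= n)%N -> (p < L)%N ->
  nth 0%N (inword kword (chain_of o) i) p = (hor o i p + dia o i p.+1)%N.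
Proof.
case: i => [|i] i_n pL /=.
  by rewrite nth_kword // hor_west // dia_west addn0.
rewrite nth_chain_of // nth_shift ?size_column // (nth_mkseq _ _ pL) /=.
congr (_ + _)%N; have [pL'|Lp] := ltnP p.+1 L; first by rewrite nth_mkseq.
rewrite nth_default ?size_column //=.
have -> : p.+1 = L by lia.
by move: i_n; rewrite leq_eqVlt => /predU1P[->|?]; [rewrite dia_east|rewrite dia_north].
Qed.

Lemma size_inword o i : (i <= n)%N -> size (inword kword (chain_of o) i) = L.
Proof.
case: i => [|i] i_n /=; first exact: size_kword.
by rewrite nth_chain_of // size_shift size_column.
Qed.

Lemma chain_of_vertex_chain o : o \in configs20V k -> vertex_chain kword (chain_of o).
Proof.
rewrite inE => /andP[ori bal].
apply/vertex_chainP; rewrite size_mkseq; split; last first.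
  apply/(all_nthP 0%N) => p; rewrite size_inword // => pL /=.
  by rewrite nth_inword // hor_east // dia_east.
move=> i i_n; rewrite nth_chain_of //; apply/andP; split.
  by rewrite /bottom_diag -nth0 nth_mkseq // /L; lia.
apply/interP; rewrite size_inword ?(ltnW i_n) //.
  by rewrite size_occupancy size_column.
exists (ver o i.+1); split=> //; first exact: ver_north top_gt0 _.
move=> p pL; rewrite nth_inword ?(ltnW i_n) // nth_occupancy nth_mkseq //=.
exact: conservation.
Qed.

Lemma config_ext o1 o2 : o1 \in configs20V k -> o2 \in configs20V k ->
  (forall z w, dom z -> dom w -> w \in nbrs z -> flow o1 z w = flow o2 z w) ->
  o1 = o2.
Proof.
rewrite !inE => /andP[/forallP ori1 _] /andP[/forallP ori2 _] e.
apply/setP => -[u v]; have [a|na] := boolP (adj u v).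
  by rewrite -!flow_vv; apply: e a; [exact: valP u|exact: valP v].
have /forallP/(_ v) := ori1 u; have /forallP/(_ v) := ori2 u.
by rewrite (negbTE na) => /negbTE-> /negbTE->.
Qed.

(** Horizontal and diagonal arrows are recorded by the chain; the vertical ones
    follow from the bottom by conservation. *)
Lemma chain_of_inj : {in configs20V k &, injective chain_of}.
Proof.
move=> o1 o2 c1 c2 e.
have /andP[ori1 bal1] : orientation o1 && [forall v, balanced o1 v].
  by move: c1; rewrite inE.
have /andP[ori2 bal2] : orientation o2 && [forall v, balanced o2 v].
  by move: c2; rewrite inE.
have hd i p : (i <= n)%N -> (p < L)%N ->
    hor o1 i p = hor o2 i p /\ dia o1 i p = dia o2 i p.
  case: i => [|i] i_n pL; first by rewrite !hor_west ?dia_west.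
  have := congr1 (fun t => nth (false, false) (nth [::] t i) p) e.
  by rewrite /chain_of !nth_mkseq // => -[].
have dL i p : (i < n)%N -> (p <= L)%N -> dia o1 i p = dia o2 i p.
  move=> i_n; rewrite leq_eqVlt => /predU1P[->|/(hd _ _ (ltnW i_n))[] //].
  by rewrite !dia_north.
have vv i p : (i < n)%N -> (p <= L)%N -> ver o1 i.+1 p = ver o2 i.+1 p.
  move=> i_n; elim: p => // p IH pL.
  have := conservation ori1 bal1 i_n pL; have := conservation ori2 bal2 i_n pL.
  have [-> _] := hd _ _ (ltnW i_n) pL; have [-> ->] := hd _ _ i_n pL.
  rewrite dL // IH ?(ltnW pL) // => -> /addnI.
  by do 2!case: ver.
apply: config_ext => // z w dz dw wz.
have [i [p [i' [p' [zE wE nb]]]]] := nbrs_ptE dz wz.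
move: dz dw wz; rewrite {}zE {}wE.
have bd i1 p1 : dom (P i1 p1) -> [/\ (0 < i1)%N, (i1 <= n)%N & (p1 < L)%N].
  by rewrite in_dom_pt => /and3P[/andP[]].
case: nb => {}i {}p dz dw wz; have [z0 zn zL] := bd _ _ dz;
  have [w0 wn wL] := bd _ _ dw.
- by have [] := hd i p zn zL.
- by have [] := hd i p.+1 zn zL.
- by case: i z0 zn {wz dz dw w0 wn} => // i _ i_n; apply: (vv i p.+1 _ (ltnW wL)).
- rewrite !(flowC (z := P i p)) // -1?nbrs_sym //; congr negb.
  by have [] := hd i p wn wL.
- rewrite !(flowC (z := P i p.+1)) // -1?nbrs_sym //; congr negb.
  by have [] := hd i p.+1 wn wL.
rewrite !(flowC (z := P i p)) // -1?nbrs_sym //; congr negb.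
by case: i z0 zn {wz dz dw w0 wn} => // i _ i_n; apply: (vv i p.+1 _ (ltnW zL)).
Qed.


(** The converse: a configuration is built from any chain t entered by the word of
    k. *)
Section FromChain.

Variable t : seq (seq (bool * bool)).
Hypothesis size_t : size t = n.
Hypothesis size_nth_t : forall i, (i < n)%N -> size (nth [::] t i) = L.
Hypothesis chain_t : vertex_chain kword t.

(** The horizontal, diagonal and vertical arrows prescribed by t, in the
    coordinates of [hor], [dia] and [ver]; column 0 carries the incoming arrows of
    the west boundary. *)
Definition hbit i p := if i is i'.+1 then (bit t i' p).1 else p \in kpos.
Definition dbit i p := if i is i'.+1 then (bit t i' p).2 else false.
Definition vbit i p :=
  if i is i'.+1 then flux false (inword kword t i') (occupancy (nth [::] t i')) p
  else false.

Lemma size_inword_t i : (i <= n)%N -> size (inword kword t i) = L.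
Proof.
case: i => [_|i i_n] /=; first exact: size_kword.
by rewrite size_shift size_nth_t.
Qed.

Lemma nth_inword_t i p : (i <= n)%N -> (p < L)%N ->
  nth 0%N (inword kword t i) p = (hbit i p + dbit i p.+1)%N.
Proof.
case: i => [|i] i_n pL /=; first by rewrite nth_kword // addn0.
by rewrite nth_shift ?size_nth_t.
Qed.

Lemma dbit0 i : (i <= n)%N -> dbit i 0 = false.
Proof.
case: i => //= i i_n; have /vertex_chainP[+ _] := chain_t.
rewrite size_t => /(_ i i_n)/andP[/negbTE + _].
by rewrite /bottom_diag -nth0.
Qed.

Lemma dbitL i : (i <= n)%N -> dbit i L = false.
Proof.
by case: i => //= i i_n; rewrite /bit nth_default ?size_nth_t.
Qed.

Lemma inter_t i : (i < n)%N ->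
  inter false (inword kword t i) (occupancy (nth [::] t i)).
Proof.
have /vertex_chainP[+ _] := chain_t.
by rewrite size_t => ch /ch /andP[].
Qed.

Lemma vbitL i : (i < n)%N -> vbit i.+1 L.
Proof.
move=> i_n; have [_ _ + _] := inter_flux (inter_t i_n).
by rewrite size_inword_t // ltnW.
Qed.

Lemma conservation_t i p : (i < n)%N -> (p < L)%N ->
  (vbit i.+1 p + (hbit i p + dbit i p.+1)
   = hbit i.+1 p + dbit i.+1 p + vbit i.+1 p.+1)%N.
Proof.
move=> i_n pL; have [_ _ _] := inter_flux (inter_t i_n).
rewrite size_inword_t ?(ltnW i_n) // => /(_ p pL).
by rewrite nth_inword_t ?(ltnW i_n) // nth_occupancy.
Qed.

Lemma bits_east p : (p < L)%N -> hbit n p = false /\ dbit n p.+1 = false.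
Proof.
move=> pL; have /vertex_chainP[_] := chain_t.
rewrite size_t => /(all_nthP 0%N)/(_ p).
rewrite size_inword_t // => /(_ pL); rewrite nth_inword_t //=.
by case: hbit; case: dbit.
Qed.

(** The chain prescribes no arrow below the domain. *)
Lemma bits_below i p : (i < n)%N -> (i.+1 + p <= n)%N ->
  [/\ hbit i.+1 p = false, dbit i.+1 p = false & vbit i.+1 p.+1 = false].
Proof.
elim: i p => [|i IHi] p i_n ipn.
  have vp : vbit 1 p = false /\ (p < L)%N; last first.
    have := conservation_t i_n vp.2; rewrite vp.1 /= addn0.
    have -> : p \in kpos = false by apply/negP => /kpos_ge; lia.
    by case: (bit _ _ _) => [[] []]; case: flux.
  split; last by rewrite /L; lia.
  elim: p ipn => [|p IH] ipn; first by have [] := inter_flux (inter_t i_n).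
  have pL : (p < L)%N by rewrite /L; lia.
  have := conservation_t i_n pL; rewrite IH /= ?addn0; last lia.
  have -> : p \in kpos = false by apply/negP => /kpos_ge; lia.
  by case: (bit _ _ _) => [[] []]; case: flux.
have vp : vbit i.+2 p = false /\ (p < L)%N; last first.
  have := conservation_t i_n vp.2; rewrite vp.1.
  have [-> _ _] := IHi p (ltnW i_n) ltac:(lia).
  have [_ -> _] := IHi p.+1 (ltnW i_n) ltac:(lia).
  by case: hbit; case: dbit; case: vbit.
split; last by rewrite /L; lia.
elim: p ipn => [|p IH] ipn; first by have [] := inter_flux (inter_t i_n).
have pL : (p < L)%N by rewrite /L; lia.
have := conservation_t i_n pL; rewrite IH; last lia.
have [-> _ _] := IHi p (ltnW i_n) ltac:(lia).
have [_ -> _] := IHi p.+1 (ltnW i_n) ltac:(lia).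
by case: hbit; case: dbit; case: vbit.
Qed.

(** Is the edge joining the neighbouring sites a and b directed from a to b in
    the configuration built from t?  False when they are not neighbours. *)
Definition arrow (a b : nat * nat) : bool :=
  if (b.1 == a.1.+1) && (b.2 == a.2) then hbit a.1 a.2
  else if (b.1 == a.1.+1) && (a.2 == b.2.+1) then dbit a.1 a.2
  else if (b.1 == a.1) && (b.2 == a.2.+1) then vbit b.1 b.2
  else if (a.1 == b.1.+1) && (a.2 == b.2) then ~~ hbit b.1 b.2
  else if (a.1 == b.1.+1) && (b.2 == a.2.+1) then ~~ dbit b.1 b.2
  else if (a.1 == b.1) && (a.2 == b.2.+1) then ~~ vbit a.1 a.2
  else false.

Lemma arrow_sym i p i' p' : pt_nbrs i p i' p' ->
  arrow (i, p) (i', p') = ~~ arrow (i', p') (i, p).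
Proof.
by case=> {}i {}p; rewrite /arrow /= ?eqxx ?(gtn_eqF (ltnSn _))
  ?(ltn_eqF (ltnSn _)) ?(ltn_eqF (ltnW (ltnSn _.+1))) ?andbF /= ?negbK.
Qed.

Lemma arrow_E i p : arrow (i, p) (i.+1, p) = hbit i p.
Proof. by rewrite /arrow /= !eqxx. Qed.

Lemma arrow_SE i p : arrow (i, p.+1) (i.+1, p) = dbit i p.+1.
Proof. by rewrite /arrow /= !eqxx (ltn_eqF (ltnSn p)). Qed.

Lemma arrow_N i p : arrow (i, p) (i, p.+1) = vbit i p.+1.
Proof. by rewrite /arrow /= !eqxx (ltn_eqF (ltnSn i)). Qed.

Lemma arrow_W i p : arrow (i.+1, p) (i, p) = ~~ hbit i p.
Proof. by rewrite (arrow_sym (NbrW i p)) arrow_E. Qed.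

Lemma arrow_NW i p : arrow (i.+1, p) (i, p.+1) = ~~ dbit i p.+1.
Proof. by rewrite (arrow_sym (NbrNW i p)) arrow_SE. Qed.

Lemma arrow_S i p : arrow (i, p.+1) (i, p) = ~~ vbit i p.+1.
Proof. by rewrite (arrow_sym (NbrS i p)) arrow_N. Qed.

Lemma arrow_nbrs i p i' p' : arrow (i, p) (i', p') -> pt_nbrs i p i' p'.
Proof.
rewrite /arrow /=.
case: ifP => [/andP[/eqP-> /eqP->] _|_]; first exact: NbrE.
case: ifP => [/andP[/eqP-> /eqP->] _|_]; first exact: NbrSE.
case: ifP => [/andP[/eqP-> /eqP->] _|_]; first exact: NbrN.
case: ifP => [/andP[/eqP-> /eqP->] _|_]; first exact: NbrW.
case: ifP => [/andP[/eqP-> /eqP->] _|_]; first exact: NbrNW.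
by case: ifP => [/andP[/eqP-> /eqP->] _|_] //; exact: NbrS.
Qed.

Lemma pt_nbrs_sym i p i' p' : pt_nbrs i p i' p' -> pt_nbrs i' p' i p.
Proof. by case=> *; constructor. Qed.

(** Inverse of [pt] on the sites. *)
Definition site (z : point) : nat * nat := (absz z.1, absz (z.2 + n%:Z - 1)%R).

Lemma sitePt i p : site (P i p) = (i, p).
Proof. by rewrite /site /P /pt /=; congr pair; lia. Qed.

Definition config_of : {set vertex n (top k) * vertex n (top k)} :=
  [set uv | arrow (site (val uv.1)) (site (val uv.2))].

Lemma config_of_orientation : orientation config_of.
Proof.
apply/forallP => u; apply/forallP => v; rewrite !inE /=.
case: ifP => [uv|/negbT uv].
  have [i [p [i' [p' [-> -> nb]]]]] := nbrs_ptE (valP u) uv.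
  by rewrite !sitePt (arrow_sym nb) addNb addbb.
apply: contra uv; rewrite /adj.
have [i [p zE]] := dom_ptE (valP u); have [i' [p' wE]] := dom_ptE (valP v).
by rewrite zE wE !sitePt => /arrow_nbrs /pt_nbrs_nbrs; rewrite -zE -wE.
Qed.

Lemma flow_config_of i p i' p' : pt_nbrs i p i' p' ->
  dom (P i p) || dom (P i' p') ->
  flow config_of (P i p) (P i' p') = arrow (i, p) (i', p').
Proof.
wlog dz : i p i' p' / dom (P i p) => [IH nb /orP[dz|dw]|nb _].
- by apply: IH => //; rewrite dz.
- rewrite (flowC config_of_orientation _ dw); last first.
    exact/pt_nbrs_nbrs/pt_nbrs_sym.
  by rewrite (arrow_sym nb) IH ?dw //; exact: pt_nbrs_sym.
have [dw|dw] := boolP (dom (P i' p')).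
  have -> : P i p = val (Sub (P i p) dz : vertex n (top k)) by [].
  have -> : P i' p' = val (Sub (P i' p') dw : vertex n (top k)) by [].
  by rewrite flow_vv inE !SubK !sitePt.
rewrite flow_out // boundary_in_pt.
move: dz dw; rewrite !in_dom_pt => /and3P[/andP[i0 i_n] pL nip].
case: nb i0 i_n pL nip => {}i {}p i0 i_n pL nip dw.
- have -> : i = n by move: dw; lia.
  by rewrite arrow_E (ltn_eqF pL) eqxx; have [->] := bits_east pL.
- have -> : i = n by move: dw; lia.
  by rewrite arrow_SE (ltn_eqF (ltnW pL)) eqxx; have [_ ->] := bits_east (ltnW pL).
- have pE : p.+1 = L by move: dw; lia.
  case: i i0 i_n {nip dw} => // i _ i_n.
  by rewrite arrow_N pE eqxx vbitL.
- rewrite arrow_W (ltn_eqF pL) (ltn_eqF (leqW i_n)) eqxx /=.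
  case: i i0 i_n nip dw => [|i] _ i_n nip dw //=.
  have ip : (i.+1 + p <= n)%N by move: dw; lia.
  by have [/= -> _ _] := bits_below (ltnW i_n) ip.
- rewrite arrow_NW (gtn_eqF (ltnSn p)) (ltn_eqF (leqW i_n)) /= !if_same.
  case: i i0 i_n nip dw => [|i] _ i_n nip dw //=.
  have -> : p.+1 = L by move: dw; lia.
  by rewrite -[X in _ = ~~ X]/(dbit i.+1 L) dbitL // ltnW.
- case: i i0 i_n nip dw => // i _ i_n nip dw.
  rewrite arrow_S (ltn_eqF (ltnW pL)) eqSS (ltn_eqF i_n) /=.
  have ip : (i.+1 + p <= n)%N by move: dw; lia.
  by have [_ _ /= ->] := bits_below i_n ip.
Qed.

Lemma config_of_balanced v : balanced config_of v.
Proof.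
have [i [p vE]] := dom_ptE (valP v).
have dv : dom (P i p) by rewrite -vE; exact: valP.
case: i vE dv => [|i] vE dv; first by move: dv; rewrite in_dom_pt.
case: p vE dv => [|p] vE dv; first by move: dv; rewrite in_dom_pt; lia.
rewrite (balanced_pt config_of_orientation vE) /ver /hor /dia.
rewrite !flow_config_of ?dv ?orbT //; try by constructor.
move: (dv); rewrite in_dom_pt => /and3P[/andP[_ i_n] pL _].
rewrite !(arrow_E, arrow_SE, arrow_N).
exact/eqP/conservation_t.
Qed.

Lemma config_of_in : config_of \in configs20V k.
Proof.
rewrite inE config_of_orientation; apply/forallP => v.
exact: config_of_balanced.
Qed.

Lemma chain_of_config_of : chain_of config_of = t.
Proof.
apply: (@eq_from_nth _ [::]) => [|i]; rewrite size_mkseq ?size_t // => i_n.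
rewrite nth_chain_of //.
apply: (@eq_from_nth _ (false, false)) => [|p];
  rewrite size_column ?size_nth_t // => pL.
rewrite nth_mkseq //.
have [ipn|nip] := leqP (i.+1 + p) n.
  have [/= h0 d0 _] := bits_below i_n ipn.
  by rewrite hor_below // dia_below //; move: h0 d0; rewrite /bit;
     case: (nth _ _ p) => a b /= -> ->.
have dz : dom (P i.+1 p) by rewrite in_dom_pt; lia.
rewrite {1}/hor flow_config_of ?dz //; last by constructor.
rewrite arrow_E; case: p dz {pL nip} => [|p] dz.
  by have := dbit0 i_n; rewrite -[dia _ _ _]/false /= /bit; case: nth => a b /= ->.
rewrite /dia flow_config_of ?dz //; last by constructor.
by rewrite arrow_SE /= /bit; case: nth.
Qed.

End FromChain.

End Flow.

(** [chain_of] with values in a finite type. *)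
Definition chain_tuple n (k : n.-tuple nat)
    (o : {set vertex n (top k) * vertex n (top k)})
    : n.-tuple ((top k + n).-tuple (bool * bool)) :=
  [tuple [tuple (hor o i.+1 p, dia o i.+1 p) | p < top k + n] | i < n].

Lemma map_enum_ord (T : Type) (f : nat -> T) m :
  [seq f (i : 'I_m) | i <- enum 'I_m] = mkseq f m.
Proof. by rewrite (map_comp f val) val_enum_ord. Qed.

Lemma chain_tupleE n (k : n.-tuple nat) (o : {set vertex n (top k) * vertex n (top k)}) :
  map val (chain_tuple o) = chain_of o.
Proof.
rewrite /chain_tuple /= -map_comp /chain_of -map_enum_ord.
by apply: eq_map => i; rewrite /= /column -map_enum_ord.
Qed.

Lemma card_configs n (k : n.-tuple nat) :
  (0 < n)%N -> sorted ltn k -> all (fun j => 1 <= j)%N k ->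
  #|configs20V k|%:R = vertex_sum (top k + n) n (kword k).
Proof.
move=> n0 ks kpos; rewrite vertex_sum_card -(card_in_imset (f := @chain_tuple n k)).
  congr _%:R; apply: eq_card => t; rewrite !inE; apply/imsetP/idP.
    by case=> o co ->; rewrite chain_tupleE; exact: chain_of_vertex_chain.
  move=> ct; have st : size (map val t) = n by rewrite size_map size_tuple.
  have sn i : (i < n)%N -> size (nth [::] (map val t) i) = (top k + n)%N.
    by move=> i_n; rewrite (nth_map (tnth t (Ordinal i_n))) ?size_tuple.
  exists (config_of k (map val t)).
    exact: config_of_in.
  apply: val_inj; apply: (inj_map val_inj).
  by rewrite /= chain_tupleE chain_of_config_of.
move=> o1 o2 c1 c2 e; apply: chain_of_inj => //.
by rewrite -!chain_tupleE e.
Qed.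

(** * Occupation words of sorted sequences *)

(** The number of occurrences in r of each position below L. *)
Definition occ L (r : seq nat) := mkseq (fun p => count_mem p r) L.

(** The number of entries of r smaller than p. *)
Definition below (r : seq nat) p := count (fun v => v < p)%N r.

Lemma belowS r p : below r p.+1 = (below r p + count_mem p r)%N.
Proof.
elim: r => //= a r IH; rewrite /below /= in IH *; rewrite IH.
by rewrite ltnS leq_eqVlt; case: eqP => [->|]; rewrite ?ltnn /=; lia.
Qed.

Lemma below0 r : below r 0 = 0%N.
Proof. by rewrite /below (@eq_count _ _ pred0) ?count_pred0. Qed.

Lemma belowL L r : all (ltn^~ L) r -> below r L = size r.
Proof. by rewrite all_count => /eqP. Qed.

Lemma below_nth r p j : sorted leq r -> (j < size r)%N ->
  (nth 0 r j < p)%N = (j < below r p)%N.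
Proof.
rewrite /below; elim: r j => // a r IH j ar jr.
have [ap|pa] := ltnP a p; rewrite /= ?ap.
  by case: j jr => [|j] jr /=; rewrite ?ap // IH ?(path_sorted ar).
have /allP ge : all (leq a) r by exact: order_path_min leq_trans ar.
rewrite (ltnNge a) pa /= (@eq_in_count _ _ pred0) ?count_pred0 ?ltn0 ?add0n; last first.
  by move=> v /ge av /=; apply/negbTE; rewrite -leqNgt (leq_trans pa).
apply/negbTE; rewrite -leqNgt.
by case: j jr => //= j jr; apply: leq_trans pa _; apply/ge/mem_nth.
Qed.

Lemma nth_lt L r j : all (ltn^~ L) r -> (j < size r)%N -> (nth 0 r j < L)%N.
Proof. by move=> /allP rL jr; apply/rL/mem_nth. Qed.

Lemma below_le_size r p : (below r p <= size r)%N.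
Proof. exact: count_size. Qed.

(** The interlacing condition between consecutive rows of a Gelfand-Tsetlin
    pattern. *)
Definition interlace (r r' : seq nat) :=
  forall j, (j < size r')%N -> (nth 0 r j <= nth 0 r' j <= nth 0 r j.+1)%N.

Lemma size_occ L r : size (occ L r) = L. Proof. exact: size_mkseq. Qed.

Lemma nth_occ L r p : (p < L)%N -> nth 0%N (occ L r) p = count_mem p r.
Proof. by move=> pL; rewrite nth_mkseq. Qed.

(** Interlacing of rows and interlacing of words agree: both say that [below r' p]
    and [below r p] differ by 0 or 1, the difference being the vertical arrow
    below p. *)
Lemma inter_occ L r r' : size r = (size r').+1 ->
  sorted leq r -> sorted leq r' -> all (ltn^~ L) r -> all (ltn^~ L) r' ->
  reflect (interlace r r') (inter false (occ L r) (occ L r')).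
Proof.
move=> sr so so' rL r'L.
apply: (iffP (interP _ _)) => [|[U]|int]; rewrite ?size_occ //.
  move=> [U0 UL Up].
  have b p : (p <= L)%N -> below r p = (below r' p + U p)%N.
    elim: p => [|p IH] pL; first by rewrite !below0 U0.
    have := Up p pL; rewrite !nth_occ // !belowS IH ?(ltnW pL) //; lia.
  have L1 j : (j < size r')%N -> (nth 0%N r' j < L)%N.
    exact: nth_lt r'L.
  have L2 j : (j < size r)%N -> (nth 0%N r j < L)%N.
    by move=> jr; apply: (allP rL) (mem_nth _ _).
  move=> j jr; apply/andP; split; rewrite -ltnS below_nth //; try lia.
    apply: (@leq_trans (below r' (nth 0 r' j).+1)).
      by rewrite -below_nth.
    by rewrite b ?L1 // leq_addr.
  have jr1 : (j.+1 < size r)%N by lia.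
  have : (j.+1 < below r (nth 0 r j.+1).+1)%N by rewrite -below_nth.
  by rewrite b ?L2 //; lia.
exists (fun p => below r' p < below r p)%N.
have b p : (below r' p <= below r p <= (below r' p).+1)%N.
  apply/andP; split; rewrite leqNgt; apply/negP => lt.
    have jr : (below r p < size r')%N by apply: leq_trans lt (below_le_size _ _).
    move: (lt); rewrite -below_nth // => lt'.
    have /andP[le _] := int _ jr.
    by have := leq_ltn_trans le lt'; rewrite below_nth ?ltnn // sr leqW.
  have jr : ((below r' p).+1 < size r)%N by apply: leq_trans lt (below_le_size _ _).
  move: (lt); rewrite -below_nth // => lt'.
  have jr' : (below r' p < size r')%N by rewrite sr in jr.
  have /andP[_ le] := int _ jr'.
  by have := leq_ltn_trans le lt'; rewrite below_nth ?ltnn.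
split; first by rewrite !below0.
  by rewrite !belowL // sr.
move=> p pL; rewrite !nth_occ //.
have := b p; have := b p.+1; rewrite !belowS; lia.
Qed.

(** The weakly increasing sequence in which b + p occurs as often as the p-th
    letter of w says. *)
Fixpoint unocc (b : nat) (w : seq nat) : seq nat :=
  if w is a :: w' then nseq a b ++ unocc b.+1 w' else [::].

Lemma size_unocc b w : size (unocc b w) = sumn w.
Proof. by elim: w b => //= a w IH b; rewrite size_cat size_nseq IH. Qed.

Lemma unocc_bounds b w : all (fun v => b <= v < b + size w)%N (unocc b w).
Proof.
elim: w b => //= a w IH b; rewrite all_cat all_nseq; apply/andP; split.
  by rewrite leqnn; case: a; rewrite //= addnS ltnS leq_addr.
by apply: sub_all (IH b.+1) => v /=; lia.
Qed.

Lemma sorted_unocc b w : sorted leq (unocc b w).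
Proof.
elim: w b => //= a w IH b.
rewrite (sorted_pairwise leq_trans) pairwise_cat -!(sorted_pairwise leq_trans) IH.
rewrite andbT; apply/andP; split.
  apply/allrelP => u v; rewrite mem_nseq => /andP[_ /eqP ->].
  by move=> /(allP (unocc_bounds _ _)) /andP[/ltnW].
by elim: a => // -[|a] //= ->; rewrite leqnn.
Qed.

Lemma count_unocc b w p : count_mem (b + p)%N (unocc b w) = nth 0%N w p.
Proof.
elim: w b p => [|a w IH] b p /=; first by rewrite nth_nil.
rewrite count_cat count_nseq /=; case: p => [|p] /=.
  rewrite addn0 eqxx mul1n (@eq_in_count _ _ pred0) ?count_pred0 ?addn0 //.
  by move=> v /(allP (unocc_bounds _ _)) /= /andP[bv _]; rewrite gtn_eqF.
by rewrite -addSnnS IH -{1}[b]addn0 (ltn_eqF (m := b + 0)) // addSnnS ltn_add2l.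
Qed.

Lemma occ_unocc w : occ (size w) (unocc 0 w) = w.
Proof.
apply: (@eq_from_nth _ 0%N); rewrite size_occ // => p pw.
by rewrite nth_occ // -[p in LHS]add0n count_unocc.
Qed.

Lemma sumn_occ L r : all (ltn^~ L) r -> sumn (occ L r) = size r.
Proof.
move=> rL; rewrite -(belowL rL).
rewrite /occ; elim: L {rL} => [|L IH]; first by rewrite below0.
by rewrite belowS -IH /mkseq -addn1 iotaD map_cat sumn_cat /= addn0.
Qed.

Lemma occ_inj L r r' : sorted leq r -> sorted leq r' ->
  all (ltn^~ L) r -> all (ltn^~ L) r' -> occ L r = occ L r' -> r = r'.
Proof.
move=> so so' rL r'L e.
apply: (sorted_eq leq_trans anti_leq) => //.
apply/allP => p; rewrite mem_cat => pr; apply/eqP.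
have pL : (p < L)%N by case/orP: pr => [/(allP rL)|/(allP r'L)].
by rewrite -(nth_occ r pL) e nth_occ.
Qed.

Lemma nth_sorted_eq r p j : sorted leq r -> (j < size r)%N ->
  (nth 0%N r j == p) = (below r p <= j < below r p.+1)%N.
Proof.
move=> so jr; rewrite eqn_leq andbC -[(_ <= p)%N]ltnS below_nth //.
by rewrite [(p <= _)%N]leqNgt below_nth // -leqNgt.
Qed.

Definition no_triple (r : seq nat) :=
  forall j, (j.+2 < size r)%N ->
    ~~ ((nth 0 r j == nth 0 r j.+1) && (nth 0 r j.+1 == nth 0 r j.+2))%N.

Lemma occ_le2P L r : sorted leq r -> all (ltn^~ L) r ->
  reflect (no_triple r) (all (leq^~ 2%N) (occ L r)).
Proof.
move=> so rL; apply: (iffP (all_nthP 0%N)).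
  rewrite size_occ => le2 j jr; apply/negP => /andP[/eqP e1 /eqP e2].
  have pL : (nth 0 r j < L)%N by apply: (nth_lt rL); lia.
  have := le2 _ pL; rewrite nth_occ //.
  have := nth_sorted_eq (nth 0%N r j) so (ltnW (ltnW jr)).
  have := nth_sorted_eq (nth 0%N r j) so jr.
  rewrite -e2 -e1 eqxx belowS => /esym + /esym; lia.
move=> nt p; rewrite size_occ => pL; rewrite nth_occ // leqNgt; apply/negP => gt2.
have bp := belowS r p; have bs := below_le_size r p.+1.
have e j : (below r p <= j < below r p.+1)%N -> nth 0%N r j = p.
  by move=> jb; apply/eqP; rewrite nth_sorted_eq //; lia.
have /negP[] := nt (below r p) ltac:(lia).
by rewrite !e ?eqxx //; lia.
Qed.

(** When no value occurs three times, each equal consecutive pair of a sorted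
    sequence is a letter 2 of its occupation word. *)
Lemma count_pairs L r : sorted leq r -> all (ltn^~ L) r ->
  all (leq^~ 2%N) (occ L r) ->
  (\sum_(j < (size r).-1) (nth 0 r j == nth 0 r j.+1) = doubles (occ L r))%N.
Proof.
move=> so rL le2.
have -> : doubles (occ L r) = (\sum_(p < L) (count_mem (p : nat) r == 2))%N.
  rewrite /doubles /occ -sum1_count big_map big_mkcond /= -{1}[L]subn0.
  by rewrite -/(index_iota 0 L) big_mkord; apply: eq_bigr => p _; case: eqP.
transitivity (\sum_(j < (size r).-1) \sum_(p < L)
   ((nth 0 r j == p) && (nth 0 r j.+1 == p)))%N.
  apply: eq_bigr => j _; have jr : (j < size r)%N by case: j => j /=; lia.
  have pL : (nth 0 r j < L)%N by exact: (nth_lt rL jr).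
  rewrite (bigD1 (Ordinal pL)) //= eqxx big1 ?addn0 /=; last first.
    by move=> p; rewrite -val_eqE /= eq_sym => /negbTE ->.
  by rewrite eq_sym.
rewrite exchange_big /=; apply: eq_bigr => p _.
have bp := belowS r p; have bs := below_le_size r p.+1.
have cp : (count_mem (p : nat) r <= 2)%N.
  by rewrite -(nth_occ r (ltn_ord p)); apply: (allP le2);
    apply: mem_nth; rewrite size_occ.
have e (j : nat) : (j < (size r).-1)%N ->
  (nth 0%N r j == p) && (nth 0%N r j.+1 == p) =
  (count_mem (p : nat) r == 2) && (j == below r p).
  by move=> jr; rewrite !nth_sorted_eq //; lia.
under eq_bigr => j _ do rewrite e //.
case: eqP => c2 /=; last by rewrite big1.
have jr : (below r p < (size r).-1)%N by lia.
rewrite (bigD1 (Ordinal jr)) //= eqxx big1 //.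
by move=> j; rewrite -val_eqE /= => /negbTE ->.
Qed.

(** * Gelfand-Tsetlin patterns as chains *)

(** The matrix library also has a row and a col. *)
Local Notation row := Defs.row.
Local Notation col := Defs.col.

(** A list of successively interlacing words below x, the last one carrying no
    particle. *)
Fixpoint pattern_chain (x : seq nat) (t : seq (seq nat)) : bool :=
  if t is z :: t' then inter false x z && pattern_chain z t' else all (pred1 0%N) x.

Lemma pattern_sum_chain L N x :
  pattern_sum L N x =
  \sum_(t : N.-tuple (L.-tuple 'I_3) | pattern_chain x (map (@word L) t))
     2 ^+ 'C(N, 2) * 2^-1 ^+ sumn (map doubles (map (@word L) t)).
Proof.
rewrite big_mkcond /=; elim: N x => [|N IH] x /=.
  rewrite (big_tuple0 (fun t => if pattern_chain x (map (@word L) t) then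
    2 ^+ 'C(0, 2) * 2^-1 ^+ sumn (map doubles (map (@word L) t)) else 0)) /=.
  by case: ifP.
rewrite (big_tuple_cons _ (fun t => if pattern_chain x (map (@word L) t) then
    2 ^+ 'C(N.+1, 2) * 2^-1 ^+ sumn (map doubles (map (@word L) t)) else 0)).
rewrite big_mkcond /=; apply: eq_bigr => z _.
case: ifP => xz; last by rewrite big1.
rewrite IH mulr_sumr; apply: eq_bigr => t _; case: ifP => _; last by rewrite mulr0.
by rewrite binS bin1 !exprD; ring.
Qed.

Lemma pattern_chainP x t :
  reflect ((forall i, (i < size t)%N ->
              inter false (nth [::] (x :: t) i) (nth [::] (x :: t) i.+1))
           /\ all (pred1 0%N) (nth [::] (x :: t) (size t)))
          (pattern_chain x t).
Proof.
elim: t x => [|z t IH] x /=; first by apply: (iffP idP) => [|[]].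
apply: (iffP andP) => [[xz /IH[ch fin]]|[ch fin]].
  by split=> // -[_|i] //=; rewrite ltnS => /ch.
split; first exact: (ch 0%N isT).
by apply/IH; split=> // i it; exact: (ch i.+1 it).
Qed.

(** An interlacing word has one particle less (for u = 0). *)
Lemma sumn_inter u x y : inter u x y -> (sumn x + u = (sumn y).+1)%N.
Proof.
elim: x y u => [|a x IH] [|c y] u //=; first by move->.
by move=> /andP[cu /IH]; case: eqP => /=; lia.
Qed.

Section Triangle.

Variable n : nat.
Implicit Types (q : tri n) (T : {ffun tri n -> int}).

Lemma tri_ex i j : (j < i <= n)%N -> exists q : tri n, row q = i /\ col q = j.+1.
Proof.
move=> /andP[ji i_n]; have lt1 : (i.-1 < n)%N by lia.
have lt2 : (j < n)%N by lia.
have le : (Ordinal lt2 <= Ordinal lt1)%N by rewrite /=; lia.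
exists (Sub (Ordinal lt1, Ordinal lt2) le : tri n).
by rewrite /row /col /=; split=> //; lia.
Qed.

Lemma tri_inj q r : row q = row r -> col q = col r -> q = r.
Proof.
case: q r => [[a b] ab] [[c d] cd]; rewrite /row /col /= => -[ac] [bd].
by apply: val_inj => /=; congr pair; apply: val_inj.
Qed.

Lemma tri_bounds q : [&& 0 < col q, col q <= row q & row q <= n]%N.
Proof. by case: q => [[a b] /= ab]; rewrite /col /row /= ltnS ab ltn_ord. Qed.

Lemma big_tri (F : nat -> nat -> nat) :
  (\sum_(q : tri n) F (row q) (col q) = \sum_(i < n) \sum_(j < i.+1) F i.+1 j.+1)%N.
Proof.
rewrite -(big_sub (fun p : 'I_n * 'I_n => (p.2 <= p.1)%N)
   (fun p : 'I_n * 'I_n => F p.1.+1 p.2.+1)) /=.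
rewrite (eq_bigl (fun p : 'I_n * 'I_n => xpredT p.1 && (p.2 <= p.1)%N)) //.
rewrite -(pair_big_dep xpredT (fun i j : 'I_n => j <= i)%N
   (fun i j : 'I_n => F i.+1 j.+1)) /=.
apply: eq_bigr => i _.
by rewrite (big_ord_widen n (fun j => F i.+1 j.+1)).
Qed.

(** The entry in row i (from 1) and column j + 1, shifted by n - 1 so that it is
    a position: position p stands for the height p + 1 - n.  The value 0 outside
    the triangle is irrelevant. *)
Definition entry T i j : nat :=
  if [pick q : tri n | (row q == i) && (col q == j.+1)] is Some q
  then absz (T q + n%:Z - 1)%R else 0%N.

(** Row i, as a sequence of positions; row 0 is empty. *)
Definition rowseq T i := mkseq (entry T i) i.

Lemma entryE T q i j : row q = i -> col q = j.+1 ->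
  entry T i j = absz (T q + n%:Z - 1)%R.
Proof.
rewrite /entry => ri cj; case: pickP => [r /andP[/eqP r1 /eqP r2]|/(_ q)].
  by rewrite (@tri_inj r q) // ?ri ?cj.
by rewrite ri cj !eqxx.
Qed.

Lemma size_rowseq T i : size (rowseq T i) = i. Proof. exact: size_mkseq. Qed.

Lemma nth_rowseq T i j : (j < i)%N -> nth 0%N (rowseq T i) j = entry T i j.
Proof. by move=> ji; rewrite nth_mkseq. Qed.

End Triangle.

Section Patterns.

Variables (n : nat) (k : n.-tuple nat).
Hypothesis n_gt0 : (0 < n)%N.
Hypothesis k_sorted : sorted ltn k.
Hypothesis k_gt0 : all (fun j => 1 <= j)%N k.

Let L := (top k + n)%N.

Lemma kpos_sorted : sorted leq (kpos k).
Proof.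
apply: (@homo_sorted _ _ _ ltn).
  by move=> a b; lia.
exact: k_sorted.
Qed.

Lemma kpos_lt : all (ltn^~ L) (kpos k).
Proof.
apply/allP => _ /mapP[j jk ->] /=.
have := le_top k_sorted jk; have := allP k_gt0 j jk.
by rewrite /L; lia.
Qed.

Lemma size_kpos : size (kpos k) = n. Proof. by rewrite size_map size_tuple. Qed.

Lemma nth_kpos j : (j < n)%N -> nth 0%N (kpos k) j = (nth 0%N k j + n).-1.
Proof. by move=> jn; rewrite (nth_map 0%N) ?size_tuple. Qed.

Section Pattern.

Variable T : gt_pattern k.

Lemma pattern_bounds q : (0 <= val T q)%R /\ (val T q <= (top k)%:Z)%R.
Proof.
have /andP[h0 h1] := gt_bounds T q; split=> //.
apply: le_trans h1 _; rewrite lez_nat; apply/bigmax_leqP_seq => j jk _.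
exact: le_top.
Qed.

Lemma entry_le p q :
  (entry (val T) (row p) (col p).-1 <= entry (val T) (row q) (col q).-1)%N
  = (val T p <= val T q)%R.
Proof.
rewrite (@entryE n _ p) ?(@entryE n _ q) ?prednK //.
have [p0 p1] := pattern_bounds p; have [q0 q1] := pattern_bounds q.
lia.
Qed.

Lemma rowseq_bottom : rowseq (val T) n = kpos k.
Proof.
apply: (@eq_from_nth _ 0%N); rewrite size_rowseq ?size_kpos // => j jn.
rewrite nth_rowseq // nth_kpos //.
have [q [rq cq]] := @tri_ex n n j ltac:(by rewrite jn leqnn).
rewrite (entryE _ rq cq).
have /andP[_ /forallP/(_ q)/implyP] := valP T.
rewrite rq eqxx => /(_ isT)/eqP ->; rewrite cq /=; lia.
Qed.

Lemma rowseq_interlace i : (i < n)%N ->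
  interlace (rowseq (val T) i.+1) (rowseq (val T) i).
Proof.
move=> i_n j; rewrite size_rowseq => ji.
rewrite !nth_rowseq //; try lia.
have [p [rp cp]] := @tri_ex n i j ltac:(lia).
have [q [rq cq]] := @tri_ex n i.+1 j ltac:(lia).
have [r [rr cr]] := @tri_ex n i.+1 j.+1 ltac:(lia).
have := entry_le q p; rewrite rp rq cp cq /= => ->.
have := entry_le p r; rewrite rp rr cp cr /= => ->.
have /andP[/forallP/(_ p)/forallP gt _] := valP T.
apply/andP; split.
  by have /andP[/implyP h _] := gt q; apply: h; rewrite /upright rp rq cp cq !eqxx.
by have /andP[_ /implyP h] := gt r; apply: h; rewrite /upleft rp rr cp cr !eqxx.
Qed.

Lemma rowseq_sorted i : (i <= n)%N -> sorted leq (rowseq (val T) i).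
Proof.
rewrite leq_eqVlt => /predU1P[->|i_n]; first by rewrite rowseq_bottom kpos_sorted.
apply/(sortedP 0%N) => j; rewrite size_rowseq => ji.
have /andP[_ h1] : (nth 0 (rowseq (val T) i.+1) j <= nth 0 (rowseq (val T) i) j
   <= nth 0 (rowseq (val T) i.+1) j.+1)%N.
  by apply: rowseq_interlace => //; rewrite size_rowseq ltnW.
apply: leq_trans h1 _.
by have /andP[] := rowseq_interlace i_n (j := j.+1) ltac:(by rewrite size_rowseq).
Qed.

Lemma rowseq_lt i : (i <= n)%N -> all (ltn^~ L) (rowseq (val T) i).
Proof.
move=> i_n; apply/(all_nthP 0%N) => j; rewrite size_rowseq => ji.
suff : (entry (val T) i j < L)%N by rewrite nth_rowseq.
have [p [rp cp]] := @tri_ex n i j ltac:(lia).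
have [p0 p1] := pattern_bounds p.
by rewrite (entryE _ rp cp) /L; lia.
Qed.

Lemma triple_freeP :
  reflect (forall i, (i <= n)%N -> no_triple (rowseq (val T) i))
          (triple_free (val T)).
Proof.
rewrite /triple_free; apply: (iffP idP) => [tf i i_n j|nt].
  rewrite size_rowseq => ji; apply: contra tf.
  rewrite !nth_rowseq ?(ltnW ji) ?(ltnW (ltnW ji)) //.
  have [p [rp cp]] := @tri_ex n i j ltac:(lia).
  have [q [rq cq]] := @tri_ex n i j.+1 ltac:(lia).
  have [r [rr cr]] := @tri_ex n i j.+2 ltac:(lia).
  rewrite (entryE _ rp cp) (entryE _ rq cq) (entryE _ rr cr) => e.
  apply/existsP; exists p; apply/existsP; exists q; apply/existsP; exists r.
  rewrite rp rq rr cp cq cr !eqxx !andTb.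
  have [p0 _] := pattern_bounds p; have [q0 _] := pattern_bounds q.
  have [r0 _] := pattern_bounds r; move: e; lia.
apply/existsP => -[p /existsP[q /existsP[r /and5P[/eqP rq /eqP cq /eqP rr /eqP cr]]]].
move=> /andP[/eqP e1 /eqP e2].
have /and3P[p1 p2 p3] := tri_bounds p.
have /and3P[r1 r2 r3] := tri_bounds r.
have [c cE] : exists c, col p = c.+1 by exists (col p).-1; rewrite prednK.
have /negP[] := nt (row p) p3 c ltac:(rewrite size_rowseq; lia).
rewrite !nth_rowseq ?(entryE _ (erefl (row p)) cE) //; try lia.
by rewrite (@entryE n _ q) ?(@entryE n _ r) ?cq ?cr ?cE // e1 e2 !eqxx.
Qed.

(** The occupation words of the rows n - 1, ..., 0. *)
Definition rowchain := mkseq (fun a => occ L (rowseq (val T) (n - a.+1)%N)) n.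

Lemma nth_rowchain a : (a <= n)%N ->
  nth [::] (kword k :: rowchain) a = occ L (rowseq (val T) (n - a)%N).
Proof.
by case: a => [_|a a_n] /=; rewrite ?nth_mkseq // subn0 rowseq_bottom.
Qed.

Lemma rowchain_pattern_chain : pattern_chain (kword k) rowchain.
Proof.
apply/pattern_chainP; rewrite size_mkseq; split=> [a a_n|]; last first.
  rewrite nth_rowchain // subnn /occ /rowseq /=.
  by apply/(all_nthP 0%N) => p; rewrite size_mkseq => pL; rewrite nth_mkseq.
rewrite nth_rowchain ?(ltnW a_n) // nth_rowchain //.
have -> : (n - a = (n - a.+1).+1)%N by lia.
apply/inter_occ; rewrite ?rowseq_sorted ?rowseq_lt ?size_rowseq //; try lia.
by apply: rowseq_interlace; lia.
Qed.

Lemma rowchain_le2 : triple_free (val T) ->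
  forall a, (a < n)%N -> all (leq^~ 2%N) (nth [::] rowchain a).
Proof.
move=> /triple_freeP nt a a_n; rewrite nth_mkseq //.
by apply/occ_le2P; [apply: rowseq_sorted; lia|apply: rowseq_lt; lia|apply: nt; lia].
Qed.

(** An entry is special exactly when its two upper neighbours are equal, since it
    lies between them. *)
Lemma specialE q i j : row q = i.+1 -> col q = j.+1 ->
  special (val T) q =
  [&& 0 < j, j < i & entry (val T) i j.-1 == entry (val T) i j]%N.
Proof.
move=> rq cq; have /and3P[q1 q2 q3] := tri_bounds q.
apply/andP/and3P => [[/existsP[p /andP[/andP[/eqP rp /eqP cp] /eqP e1]]]|].
  move=> /existsP[r /andP[/andP[/eqP rr /eqP cr] /eqP e2]].
  have /and3P[p1 p2 p3] := tri_bounds p; have /and3P[r1 r2 r3] := tri_bounds r.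
  split; try lia.
  rewrite (@entryE n _ p) ?(@entryE n _ r) ?e1 ?e2 //; lia.
move=> [j0 ji /eqP e].
have [p [rp cp]] := @tri_ex n i j.-1 ltac:(lia).
have [r [rr cr]] := @tri_ex n i j ltac:(lia).
have /andP[/forallP gt _] := valP T.
have /forallP/(_ q)/andP[_ /implyP gp] := gt p.
have /forallP/(_ q)/andP[/implyP gr _] := gt r.
have {}gp : (val T p <= val T q)%R.
  by apply: gp; rewrite /upleft rq rp cq cp eqxx prednK ?eqxx.
have {}gr : (val T q <= val T r)%R.
  by apply: gr; rewrite /upright rq rr cq cr !eqxx.
have [p0 _] := pattern_bounds p; have [q0 _] := pattern_bounds q.
have [r0 _] := pattern_bounds r.
move: e; rewrite (entryE _ rp cp) (entryE _ rr cr) => e.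
split; apply/existsP; [exists p|exists r].
  rewrite /upleft rq rp cq cp prednK // !eqxx !andTb; lia.
rewrite /upright rq rr cq cr !eqxx !andTb; lia.
Qed.

Lemma card_special : triple_free (val T) ->
  (\sum_(q : tri n) special (val T) q = sumn (map doubles rowchain))%N.
Proof.
move=> tf.
pose s i j := [&& 0 < j.-1, j.-1 < i.-1
   & entry (val T) i.-1 j.-2 == entry (val T) i.-1 j.-1]%N.
transitivity (\sum_(q : tri n) s (row q) (col q))%N.
  apply: eq_bigr => q _; have /and3P[q1 q2 q3] := tri_bounds q.
  rewrite (@specialE q (row q).-1 (col q).-1) ?prednK //; lia.
rewrite (big_tri n (fun i j => s i j : nat)).
rewrite sumnE big_map big_map -[n in iota 0 n]subn0 -/(index_iota 0 n) big_mkord.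
rewrite (reindex_inj rev_ord_inj) /=; apply: eq_bigr => a _.
have i_n : (n - a.+1 <= n)%N by lia.
rewrite -count_pairs; first last.
- by apply/occ_le2P; [exact: rowseq_sorted|exact: rowseq_lt|move/triple_freeP: tf; exact].
- exact: rowseq_lt.
- exact: rowseq_sorted.
rewrite size_rowseq; case E : (n - a.+1)%N => [|i]; first by rewrite big_ord1 big_ord0.
transitivity (\sum_(j < i)
    (entry (val T) i.+1 j == entry (val T) i.+1 j.+1))%N; last first.
  apply: eq_bigr => j _; have ji := ltn_ord j.
  by rewrite !nth_rowseq //; exact: leqW.
rewrite big_ord_recl big_ord_recr /= /s /= /bump /= add1n ltnn /= addn0 add0n.
by apply: eq_bigr => j _; rewrite /= !add1n add0n ltnS ltn_ord.
Qed.

End Pattern.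
End Patterns.

Section PatternSum.

Variables (n : nat) (k : n.-tuple nat).
Hypothesis n_gt0 : (0 < n)%N.
Hypothesis k_sorted : sorted ltn k.
Hypothesis k_gt0 : all (fun j => 1 <= j)%N k.

Let L := (top k + n)%N.

(** There are n + C(n, 2) entries in all. *)
Lemma card_nonspecial (T : gt_pattern k) : triple_free (val T) ->
  (#|[set q | ~~ special (val T) q]| + sumn (map doubles (rowchain T))
   = n + 'C(n, 2))%N.
Proof.
move=> tf; rewrite -card_special // -sum1dep_card big_mkcond -big_split /=.
rewrite (eq_bigr (fun=> 1%N)); last by move=> q _; case: special.
rewrite (big_tri n (fun _ _ => 1%N)).
under eq_bigr => i _ do rewrite sum1_card card_ord -addn1.
by rewrite big_split /= sum1_card card_ord addnC -(big_mkord xpredT id) bin2_sum.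
Qed.

Lemma weight_chain (T : gt_pattern k) : triple_free (val T) ->
  (weightFSA (val T))%:R =
  2 ^+ n * (2 ^+ 'C(n, 2) * 2^-1 ^+ sumn (map doubles (rowchain T))) :> rat.
Proof.
move=> tf; rewrite mulrA -exprD -(card_nonspecial tf) exprD -mulrA -exprMn divff //.
by rewrite expr1n mulr1 /weightFSA natrX.
Qed.

(** [rowchain] with values in a finite type; faithful for triple-free patterns. *)
Definition pattern_words (T : gt_pattern k) : n.-tuple (L.-tuple 'I_3) :=
  [tuple [tuple inord (nth 0 (nth [::] (rowchain T) a) p) | p < L] | a < n].

Lemma pattern_wordsE (T : gt_pattern k) : triple_free (val T) ->
  map (@word L) (pattern_words T) = rowchain T.
Proof.
move=> tf; rewrite /pattern_words /= -map_comp.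
rewrite [RHS](_ : _ = mkseq (nth [::] (rowchain T)) n); last first.
  by rewrite -[LHS](mkseq_nth [::]) size_mkseq.
rewrite -map_enum_ord; apply: eq_map => a /=.
have le2 := rowchain_le2 n_gt0 k_sorted k_gt0 tf (ltn_ord a).
have sL : size (nth [::] (rowchain T) a) = L by rewrite nth_mkseq // size_occ.
rewrite /word /= -map_comp -[RHS](mkseq_nth 0%N) sL -map_enum_ord.
apply: eq_map => p /=; rewrite inordK // ltnS.
by apply: (all_nthP 0%N le2); rewrite sL.
Qed.

Lemma rowchain_inj (T1 T2 : gt_pattern k) : rowchain T1 = rowchain T2 -> T1 = T2.
Proof.
move=> e; apply: val_inj; apply/ffunP => q.
have /and3P[q1 q2 q3] := tri_bounds q.
have e' : rowseq (val T1) (row q) = rowseq (val T2) (row q).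
  apply: (@occ_inj L); rewrite ?rowseq_sorted ?rowseq_lt //.
  have := congr1 (fun s => nth [::] (kword k :: s) (n - row q)) e.
  by rewrite !nth_rowchain ?leq_subr // subKn.
have := congr1 (fun s => nth 0%N s (col q).-1) e'.
rewrite !nth_rowseq // !(@entryE n _ q) //.
have [p1 _] := pattern_bounds k_sorted T1 q.
have [p2 _] := pattern_bounds k_sorted T2 q.
lia.
Qed.

(** The converse: a pattern is built from any chain t of words below that of k. *)
Section FromWords.

Variable t : seq (seq nat).
Hypothesis size_t : size t = n.
Hypothesis size_nth_t : forall a, (a < n)%N -> size (nth [::] t a) = L.
Hypothesis le2_t : forall a, (a < n)%N -> all (leq^~ 2%N) (nth [::] t a).
Hypothesis chain_t : pattern_chain (kword k) t.

Let w a := nth [::] (kword k :: t) a.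

Lemma size_w a : (a <= n)%N -> size (w a) = L.
Proof.
by case: a => [|a] an; rewrite /w /=; [exact: size_kword|exact: size_nth_t].
Qed.

Lemma sumn_w a : (a <= n)%N -> sumn (w a) = (n - a)%N.
Proof.
elim: a => [_|a IH an].
  by rewrite /w /= subn0 -{2}(size_kpos k); apply: sumn_occ; exact: kpos_lt.
have /pattern_chainP[ch _] := chain_t.
have := sumn_inter (ch a ltac:(by rewrite size_t)).
by rewrite -/(w a) -/(w a.+1) IH ?(ltnW an) //; lia.
Qed.

(** Row i of the pattern, the word of index 0 being that of k. *)
Definition row_of i := unocc 0 (w (n - i)).

Lemma size_row_of i : (i <= n)%N -> size (row_of i) = i.
Proof. by move=> i_n; rewrite size_unocc sumn_w ?leq_subr // subKn. Qed.

Lemma row_of_lt i : (i <= n)%N -> all (ltn^~ L) (row_of i).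
Proof.
by move=> i_n; have := unocc_bounds 0 (w (n - i)); rewrite size_w ?leq_subr.
Qed.

Lemma row_of_sorted i : sorted leq (row_of i).
Proof. exact: sorted_unocc. Qed.

Lemma occ_row_of i : (i <= n)%N -> occ L (row_of i) = w (n - i).
Proof. by move=> i_n; rewrite -(@size_w (n - i)) ?leq_subr // occ_unocc. Qed.

Lemma row_of_bottom : row_of n = kpos k.
Proof.
apply: (@occ_inj L); rewrite ?row_of_sorted ?row_of_lt ?kpos_sorted ?kpos_lt //.
by rewrite occ_row_of // subnn.
Qed.

Lemma row_of_interlace i : (i < n)%N -> interlace (row_of i.+1) (row_of i).
Proof.
move=> i_n; apply/(@inter_occ L).
- by rewrite !size_row_of // ltnW.
- exact: row_of_sorted.
- exact: row_of_sorted.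
- exact: row_of_lt.
- by apply: row_of_lt; exact: ltnW.
rewrite !occ_row_of ?(ltnW i_n) //.
have /pattern_chainP[ch _] := chain_t.
have -> : (n - i = (n - i.+1).+1)%N by lia.
by apply: ch; rewrite size_t; lia.
Qed.

Definition array_of : {ffun tri n -> int} :=
  [ffun q => (nth 0%N (row_of (row q)) (col q).-1)%:Z + 1 - n%:Z].

Lemma array_of_pattern : is_gt array_of && bottom_row k array_of.
Proof.
apply/andP; split; last first.
  apply/forallP => q; apply/implyP => /eqP rq; have /and3P[q1 q2 q3] := tri_bounds q.
  rewrite ffunE rq row_of_bottom nth_kpos; last by lia.
  have kj : (0 < nth 0 k (col q).-1)%N.
    by apply: (allP k_gt0); apply: mem_nth; rewrite size_tuple; lia.
  by apply/eqP; lia.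
apply/forallP => p; apply/forallP => q; have /and3P[p1 p2 p3] := tri_bounds p.
have /and3P[q1 q2 q3] := tri_bounds q.
rewrite !ffunE; apply/andP; split; apply/implyP => /andP[/eqP rq /eqP cq].
  have := @row_of_interlace (row p) ltac:(lia) (col p).-1.
  rewrite size_row_of // rq cq => /(_ ltac:(lia)) /andP[h _]; lia.
have := @row_of_interlace (row p) ltac:(lia) (col p).-1.
rewrite size_row_of // rq cq prednK // succnK => /(_ ltac:(lia)) /andP[_ h]; lia.
Qed.

Definition pattern_of : gt_pattern k := Sub array_of array_of_pattern.

Lemma rowseq_pattern_of i : (i <= n)%N -> rowseq (val pattern_of) i = row_of i.
Proof.
move=> i_n; apply: (@eq_from_nth _ 0%N); rewrite size_rowseq ?size_row_of //.
move=> j ji; have [q [rq cq]] := @tri_ex n i j ltac:(lia).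
by rewrite nth_rowseq // (entryE _ rq cq) SubK ffunE rq cq /=; lia.
Qed.

Lemma rowchain_pattern_of : rowchain pattern_of = t.
Proof.
apply: (@eq_from_nth _ [::]); rewrite size_mkseq ?size_t // => a an.
rewrite nth_mkseq // rowseq_pattern_of ?leq_subr // occ_row_of ?leq_subr //.
by rewrite subKn.
Qed.

Lemma pattern_of_triple_free : triple_free (val pattern_of).
Proof.
apply/triple_freeP => // i i_n; rewrite rowseq_pattern_of //.
apply/(@occ_le2P L); [exact: row_of_sorted|exact: row_of_lt|rewrite occ_row_of //].
case E : (n - i)%N => [|a]; rewrite /w /=; last by apply: le2_t; lia.
apply/(all_nthP 0%N) => p; rewrite size_kword => pL /=.
by rewrite nth_kword //; case: (p \in _).
Qed.

End FromWords.

Lemma sum_patterns :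
  \sum_(T : gt_pattern k | triple_free (val T)) (weightFSA (val T))%:R
  = 2 ^+ n * pattern_sum L n (kword k) :> rat.
Proof.
pose g (t : n.-tuple (L.-tuple 'I_3)) : rat :=
  2 ^+ n * (2 ^+ 'C(n, 2) * 2^-1 ^+ sumn (map doubles (map (@word L) t))).
rewrite pattern_sum_chain mulr_sumr.
transitivity (\sum_(T in [set T : gt_pattern k | triple_free (val T)])
   g (pattern_words T)).
  rewrite big_mkcond [RHS]big_mkcond; apply: eq_bigr => T _; rewrite inE.
  by case: ifP => // tf; rewrite weight_chain // /g pattern_wordsE.
rewrite -(big_imset g) /=.
  apply: eq_bigl => t; apply/imsetP/idP => [[T]|ch].
    by rewrite inE => tf ->; rewrite pattern_wordsE // rowchain_pattern_chain.
  have st : size (map (@word L) t) = n by rewrite size_map size_tuple.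
  have nt a (an : (a < n)%N) : nth [::] (map (@word L) t) a = word (tnth t (Ordinal an)).
    rewrite (nth_map (tnth t (Ordinal an))) ?size_tuple //.
    by rewrite -(tnth_nth _ t (Ordinal an)).
  have sn a : (a < n)%N -> size (nth [::] (map (@word L) t) a) = L.
    by move=> an; rewrite nt size_word.
  have le2 a : (a < n)%N -> all (leq^~ 2%N) (nth [::] (map (@word L) t) a).
    by move=> an; rewrite nt word_le2.
  have tf := pattern_of_triple_free st sn le2 ch.
  exists (pattern_of st sn ch); first by rewrite inE.
  apply: val_inj; apply: (inj_map (@word_inj L)).
  by rewrite pattern_wordsE // rowchain_pattern_of.
move=> T1 T2; rewrite !inE => tf1 tf2 e; apply: rowchain_inj.
by rewrite -!pattern_wordsE // e.
Qed.

End PatternSum.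

Theorem theorem1p1 (n : nat) (k : n.-tuple nat) :
  (1 <= n)%N -> sorted ltn k -> all (fun j => 1 <= j)%N k ->
  #|configs20V k|%:R =
    2 ^- n * \sum_(T : gt_pattern k | triple_free (val T))
               (weightFSA (val T))%:R :> rat.
Proof.
move=> n0 ks k0; rewrite card_configs // sum_patterns // mulKf ?expf_neq0 //.
apply: vertex_sum_pattern_sum; apply/(all_nthP 0%N) => p; rewrite size_take size_kword.
move=> pn; have {pn} [pn pL] : (p < n.-1)%N /\ (p < top k + n)%N.
  by move: pn; case: ifP; lia.
rewrite nth_take // nth_kword //= eqb0; apply/negP => /kpos_ge.
by move=> /(_ k0); lia.
Qed.
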